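(* Let $\mathcal H$ be a separable Hilbert space, let $A$ and $K$ be bounded self-adjoint operators on $\mathcal H$, where $K\ge\mathbf 0$ belongs to the trace class. Let $\sigma$ be an arbitrary singular measure on $\mathbb R$. If $\operatorname{Ran} K$ is cyclic for $A$, then for all $t\in\mathbb R$ except maybe countably many, the spectral measure of $A+tK$ (equivalently, its singular part) is mutually singular with $\sigma$.
   Context: Measures on $\mathbb R$ are finite non-negative Borel measures; ''singular'' (and ''singular part'') means singular with respect to Lebesgue measure. Operators are bounded. For a self-adjoint operator $A$ on $\mathcal H$ with projection-valued spectral measure $\mathbf E$, the scalar spectral measure of $\mathbf x\in\mathcal H$ is $\mu_{\mathbf x}(\cdot)=\langle \mathbf E(\cdot)\mathbf x,\mathbf x\rangle$. A vector $\mathbf x$ has maximal spectral type if $\mu_{\mathbf y}\ll\mu_{\mathbf x}$ for every $\mathbf y\in\mathcal H$. ''The spectral measure of $A$'' means a scalar spectral measure of maximal spectral type, i.e. $\mu_{\mathbf x}$ for some $\mathbf x$ of maximal spectral type; it is unique up to mutual absolute continuity. A set $S\subset\mathcal H$ is cyclic for $A$ if the smallest closed $A$-invariant subspace containing $S$ is $\mathcal H$. *)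

(* Defs.v *)
From HB Require Import structures.
From mathcomp Require Import all_boot all_order all_algebra.
From mathcomp Require Import all_classical all_reals all_analysis.
From mathcomp Require Export complex.

Set Implicit Arguments.
Unset Strict Implicit.
Unset Printing Implicit Defensive.

Import Order.TTheory GRing.Theory Num.Def Num.Theory.
Import numFieldNormedType.Exports.

Local Open Scope classical_set_scope.
Local Open Scope ring_scope.
Local Open Scope complex_scope.

Definition separable (T : topologicalType) : Prop :=
  exists D : set T, countable D /\ dense D.

Section Operators.
Context (R : realType) (H : completeNormedModType R[i]).

(* Linear in the first argument, conjugate-linear in the second.  Together with
   the completeness of H, [inner_product dot] makes H a complex Hilbert space
   whose norm is the given one. *)
Definition inner_product (dot : {dot H for conjC}) : Prop :=
  forall x, `|x| ^+ 2 = dot x x.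

Definition bounded_operator (T : H -> H) : Prop :=
  linear T /\ exists M : R, forall x, `|T x| <= M%:C * `|x|.

Definition closed_subspace : set (set H) :=
  [set M | [/\ closed M, M 0 &
    forall (a : R[i]) x y, M x -> M y -> M (a *: x + y)]].

Definition cyclic_set (A : H -> H) (S : set H) : Prop :=
  smallest [set M | closed_subspace M /\ A @` M `<=` M] S = setT.

Variable dot : {dot H for conjC}.

Definition self_adjoint (A : H -> H) : Prop :=
  bounded_operator A /\ forall x y, dot (A x) y = dot x (A y).

(* In R[i], [0 <= z] means that z is real and nonnegative. *)
Definition positive_operator (A : H -> H) : Prop :=
  self_adjoint A /\ forall x, 0 <= dot (A x) x.

Definition orthonormal_basis (B : set H) : Prop :=
  [/\ forall e, B e -> dot e e = 1,
      forall e f, B e -> B f -> e <> f -> dot e f = 0 &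
      smallest closed_subspace B = setT].

(* [absT] is the positive square root of T^* T, which is unique. *)
Definition is_modulus (T absT : H -> H) : Prop :=
  positive_operator absT /\
  forall x y, dot (absT (absT x)) y = dot (T x) (T y).

(* The sum does not depend on the orthonormal basis. *)
Definition trace_class (T : H -> H) : Prop :=
  bounded_operator T /\
  exists (absT : H -> H) (B : set H),
    [/\ is_modulus T absT, orthonormal_basis B &
        (\esum_(e in B) (complex.Re (dot (absT e) e))%:E < +oo)%E].

Definition orthogonal_projection (P : H -> H) : Prop :=
  self_adjoint P /\ P \o P = P.

Record projection_valued_measure
    (E : set (measurableTypeR R) -> H -> H) : Prop := {
  pvm_projection : forall B, measurable B -> orthogonal_projection (E B) ;
  pvm_setT : E setT = id ;
  pvm_setI : forall B C, measurable B -> measurable C ->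
    E (B `&` C) = E B \o E C ;
  pvm_sigma_additive : forall F : nat -> set (measurableTypeR R),
    (forall n, measurable (F n)) -> trivIset setT F ->
    forall x, (fun n => \sum_(k < n) E (F k) x) @ \oo -->
              E (\bigcup_n F n) x }.

(* <E(B)x, x> is real and nonnegative for every measurable B. *)
Definition scalar_spectral_measure (E : set (measurableTypeR R) -> H -> H)
    (x : H) : set (measurableTypeR R) -> \bar R :=
  fun B => (complex.Re (dot (E B x) x))%:E.

(* A is the integral of lambda dE(lambda), in the sense of quadratic forms,
   which determine operators on a complex Hilbert space. *)
Definition spectral_resolution (A : H -> H)
    (E : set (measurableTypeR R) -> H -> H) : Prop :=
  projection_valued_measure E /\
  forall x, (scalar_spectral_measure E x).-integrable setT EFin /\
    dot (A x) x =
      (fine (\int[scalar_spectral_measure E x]_l l%:E)%E)%:C.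

Definition maximal_spectral_type (E : set (measurableTypeR R) -> H -> H)
    (x : H) : Prop :=
  forall y, scalar_spectral_measure E y `<< scalar_spectral_measure E x.

(* Not unique: every scalar spectral measure of maximal spectral type counts. *)
Definition is_spectral_measure (A : H -> H)
    (mu : {finite_measure set (measurableTypeR R) -> \bar R}) : Prop :=
  exists (E : set (measurableTypeR R) -> H -> H) (x : H),
    [/\ spectral_resolution A E, maximal_spectral_type E x &
        forall B, measurable B -> mu B = scalar_spectral_measure E x B].

End Operators.

Definition mutually_singular d (T : measurableType d) (R : realType)
    (mu nu : set T -> \bar R) : Prop :=
  exists N, [/\ measurable N, mu N = 0%E & nu (~` N) = 0%E].

Definition singular_measure (R : realType)
    (mu : {finite_measure set (measurableTypeR R) -> \bar R}) : Prop :=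
  mutually_singular mu (@lebesgue_measure R).

Definition is_singular_part (R : realType)
    (mu mu_s : {finite_measure set (measurableTypeR R) -> \bar R}) : Prop :=
  singular_measure mu_s /\
  exists mu_ac : {finite_measure set (measurableTypeR R) -> \bar R},
    mu_ac `<< @lebesgue_measure R /\
    forall B, measurable B -> mu B = (mu_ac B + mu_s B)%E.

(* Main.v *)
(** Suppose that the spectral measures of A_t = A + t K, for t in a set Z, are not
    singular to sigma.  For each such t there is a vector y_t <> 0 with
    |E_t(B) y_t|^2 <= sigma(C `&` B), where C is one of countably many bounded
    sets such that, at arbitrarily fine dyadic scales, the cells meeting C have
    arbitrarily small total length.  Consider the forms
      B_L(s, t) = sum over cells I of level L of
                  <K E_s(I) y_s, E_t(I) y_t> / sigma(C `&` I).
    For s <> t, writing (s - t) K = (A_s - a) - (A_t - a) with a in I bounds the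
    term of I by 2 |I| / |s - t|, so B_L(s, t) is small for suitable large L.
    The energies B_L(t, t) increase with L, are at most a multiple of the trace
    of K since the vectors E_t(I) y_t are orthogonal, and are eventually
    positive by cyclicity.
    If Z were uncountable, two distinct s, t in Z would share C, a level n beyond
    which both energies vary by at most d (with energies >= 4 d), and an
    approximation of the level n pieces by a countable dense set; monotonicity
    of the energy of the sum then keeps B_L(s, t) >= 5 d / 2 for all L >= n. *)

Require Import Defs.
From HB Require Import structures.
From mathcomp Require Import all_boot all_order all_algebra.
From mathcomp Require Import all_classical all_reals all_analysis complex.
From mathcomp Require Import ring lra zify.

Import Order.TTheory GRing.Theory Num.Def Num.Theory.
Import numFieldNormedType.Exports.

Set Implicit Arguments.
Unset Strict Implicit.
Unset Printing Implicit Defensive.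

Local Open Scope classical_set_scope.
Local Open Scope ring_scope.
Local Open Scope complex_scope.

Local Notation Re := complex.Re.
Local Notation Im := complex.Im.

(** * The real inner product and symmetric operators *)

Section ReInnerProduct.
Context (R : realType) (H : completeNormedModType R[i]).
Variable dot : {dot H for conjC}.

(** The inner product of H as a real Hilbert space. It induces the same norm as [dot], and estimates
    with it take place in the ordered field [R]. *)
Definition redot (x y : H) : R := Re (dot x y).

Lemma ReD (a b : R[i]) : Re (a + b) = Re a + Re b.
Proof. by case: a; case: b. Qed.

Lemma ReN (a : R[i]) : Re (- a) = - Re a.
Proof. by case: a. Qed.

Lemma ReZ (r : R) (a : R[i]) : Re (r%:C * a) = r * Re a.
Proof. by case: a => a b /=; rewrite mul0r subr0. Qed.

Lemma Re_conjC (a : R[i]) : Re (a^*)%R = Re a.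
Proof.
apply: (@complexI R).
by rewrite !complexRe Re_conj.
Qed.

Lemma dotDl x y z : dot (x + y) z = dot x z + dot y z.
Proof. by rewrite linearDl. Qed.

Lemma dotDr x y z : dot z (x + y) = dot z x + dot z y.
Proof. by rewrite linearDr. Qed.

Lemma dotZl a x z : dot (a *: x) z = a * dot x z.
Proof. by rewrite linearZl_LR. Qed.

Lemma dotZr a x z : dot z (a *: x) = (a^*)%R * dot z x.
Proof. by rewrite linearZr_LR. Qed.

Lemma dotNl x z : dot (- x) z = - dot x z.
Proof. by rewrite linearNl. Qed.

Lemma dotNr x z : dot z (- x) = - dot z x.
Proof. by rewrite linearNr. Qed.

Lemma dotC x y : dot x y = ((dot y x)^*)%R.
Proof. by rewrite hermC mul1r. Qed.

Lemma redotC x y : redot x y = redot y x.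
Proof. by rewrite /redot dotC Re_conjC. Qed.

Lemma redotDl x y z : redot (x + y) z = redot x z + redot y z.
Proof. by rewrite /redot dotDl ReD. Qed.

Lemma redotDr x y z : redot z (x + y) = redot z x + redot z y.
Proof. by rewrite /redot dotDr ReD. Qed.

Lemma redotNl x z : redot (- x) z = - redot x z.
Proof. by rewrite /redot dotNl ReN. Qed.

Lemma redotNr x z : redot z (- x) = - redot z x.
Proof. by rewrite /redot dotNr ReN. Qed.

Lemma redotBl x y z : redot (x - y) z = redot x z - redot y z.
Proof. by rewrite redotDl redotNl. Qed.

Lemma redotBr x y z : redot z (x - y) = redot z x - redot z y.
Proof. by rewrite redotDr redotNr. Qed.

Lemma redotZl (r : R) x z : redot (r%:C *: x) z = r * redot x z.
Proof. by rewrite /redot dotZl ReZ. Qed.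

Lemma redotZr (r : R) x z : redot z (r%:C *: x) = r * redot z x.
Proof. by rewrite redotC redotZl redotC. Qed.

Lemma redot0l z : redot 0 z = 0.
Proof. by rewrite -[0](subrr z) redotBl subrr. Qed.

Lemma redot0r z : redot z 0 = 0.
Proof. by rewrite redotC redot0l. Qed.

Lemma redot_suml I (r : seq I) (P : pred I) (F : I -> H) z :
  redot (\sum_(i <- r | P i) F i) z = \sum_(i <- r | P i) redot (F i) z.
Proof.
apply: (big_ind2 (fun x y => redot x z = y)) => //; first exact: redot0l.
by move=> x1 x2 y1 y2 <- <-; rewrite redotDl.
Qed.

Lemma redot_sumr I (r : seq I) (P : pred I) (F : I -> H) z :
  redot z (\sum_(i <- r | P i) F i) = \sum_(i <- r | P i) redot z (F i).
Proof. by rewrite redotC redot_suml; apply: eq_bigr => i _; rewrite redotC. Qed.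

Lemma redot_ge0 x : 0 <= redot x x.
Proof. by have := dnorm_ge0 dot x; rewrite lecE => /andP[_]. Qed.

Lemma dot_redot x : dot x x = (redot x x)%:C.
Proof. by rewrite /redot RRe_real// ger0_real// dnorm_ge0. Qed.

Lemma redot_eq0 x : (redot x x == 0) = (x == 0).
Proof.
rewrite -(dnorm_eq0 dot) dot_redot -[0 in RHS]/((0 : R)%:C).
by rewrite (inj_eq (@complexI R)).
Qed.

Lemma redot_i x y : redot ('i *: x) y = - Im (dot x y).
Proof. by rewrite /redot dotZl mulrC ReiNIm. Qed.

Hypothesis hip : inner_product dot.

Lemma norm_redot x : `|x| = (Num.sqrt (redot x x))%:C.
Proof.
apply/eqP; rewrite -(@eqrXn2 _ 2)// ?lecR ?sqrtr_ge0//.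
rewrite hip dot_redot -rmorphXn/=.
by rewrite sqr_sqrtr// redot_ge0.
Qed.

Lemma sqr_le_of_quad (a b c : R) : 0 <= a -> 0 <= c ->
  (forall r s : R, 0 <= r ^+ 2 * a + r * s * b *+ 2 + s ^+ 2 * c) ->
  b ^+ 2 <= a * c.
Proof.
move=> a0 c0 h; have [c00|cp] := eqVneq c 0.
  (* At this point the form equals - b^2, which forces b = 0. *)
  have := h b (- (a + 1) / 2); rewrite c00.
  have [->|b0] := eqVneq b 0; first by rewrite expr0n/= !mulr0.
  have : 0 < b ^+ 2 by rewrite exprn_even_gt0.
  by move=> b2; nra.
have cpos : 0 < c by rewrite lt_neqAle eq_sym cp.
(* Here the form equals c (a c - b^2). *)
have := h c (- b); nra.
Qed.

Lemma redot_CS x y : redot x y ^+ 2 <= redot x x * redot y y.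
Proof.
apply: sqr_le_of_quad; rewrite ?redot_ge0// => r s.
have := redot_ge0 (r%:C *: x + s%:C *: y).
by rewrite redotDl !redotDr !redotZl !redotZr (redotC y x) => h; lra.
Qed.

Lemma le_norm_sqr (r : R) x : 0 <= r -> (`|x| <= r%:C) = (redot x x <= r ^+ 2).
Proof.
move=> r0; rewrite norm_redot lecR -(@ler_pXn2r _ 2)// ?nnegrE ?sqrtr_ge0//.
by rewrite sqr_sqrtr// redot_ge0.
Qed.

Lemma redot_le_norm x y (a b : R) : 0 <= a -> 0 <= b ->
  redot x x <= a ^+ 2 -> redot y y <= b ^+ 2 -> `|redot x y| <= a * b.
Proof.
move=> a0 b0 hx hy; rewrite -(@ler_pXn2r _ 2)// ?nnegrE ?mulr_ge0//.
rewrite real_normK ?num_real//; apply: (le_trans (redot_CS x y)).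
by rewrite exprMn ler_pM// redot_ge0.
Qed.

End ReInnerProduct.

Section SymmetricOperators.
Context (R : realType) (H : completeNormedModType R[i]).
Variable dot : {dot H for conjC}.
Hypothesis hip : inner_product dot.
Local Notation redot := (redot dot).

Lemma closed_of_approx (M : set H) :
  (forall u, (forall e : R, 0 < e ->
     exists2 v, M v & redot (u - v) (u - v) <= e) -> M u) -> closed M.
Proof.
move=> h u clu; apply: h => e e0.
have se0 : 0 < Num.sqrt e by rewrite sqrtr_gt0.
have /clu[v [Mv]] : nbhs u (ball u (Num.sqrt e)%:C).
  by apply: nbhsx_ballx; rewrite ltcR.
rewrite -ball_normE/= => uv; exists v => //.
have := ltW uv; rewrite (le_norm_sqr hip) ?sqrtr_ge0//.
by rewrite sqr_sqrtr// ltW.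
Qed.

Lemma redot_normD x y :
  redot (x + y) (x + y) <= 2 * redot x x + 2 * redot y y.
Proof.
have := redot_ge0 dot (x - y).
by rewrite redotBl !redotBr redotDl !redotDr (redotC _ y x); lra.
Qed.

Lemma redot_norm_le x : (forall y, redot x y = 0) -> x = 0.
Proof. by move=> h; apply/eqP; rewrite -(redot_eq0 dot) h. Qed.

Section Linear.
Variable T : H -> H.
Hypothesis linT : linear T.

Lemma linD x y : T (x + y) = T x + T y.
Proof. by have := linT 1 x y; rewrite !scale1r. Qed.

Lemma lin0 : T 0 = 0.
Proof. by apply: (addIr (T 0)); rewrite -linD !add0r. Qed.

Lemma linZ a x : T (a *: x) = a *: T x.
Proof. by have := linT a x 0; rewrite !addr0 lin0 addr0. Qed.

Lemma linN x : T (- x) = - T x.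
Proof. by rewrite -scaleN1r linZ scaleN1r. Qed.

Lemma linB x y : T (x - y) = T x - T y.
Proof. by rewrite linD linN. Qed.

Lemma lin_sum I (r : seq I) (P : pred I) (F : I -> H) :
  T (\sum_(i <- r | P i) F i) = \sum_(i <- r | P i) T (F i).
Proof.
apply: (big_ind2 (fun x y => T x = y)) => //; first exact: lin0.
by move=> x1 x2 y1 y2 <- <-; rewrite linD.
Qed.

Hypothesis symT : forall x y, redot (T x) y = redot x (T y).

(** Polarization at u + r T u and u - r T u gives 2 r |T u|^2 <= d (|u|^2 + r^2 |T u|^2). The best
    choice is r = 1 / d; when d = 0, r = 1 is enough. *)
Lemma sym_form_bound (d : R) : 0 <= d ->
  (forall x, `|redot (T x) x| <= d * redot x x) ->
  forall x, redot (T x) (T x) <= d ^+ 2 * redot x x.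
Proof.
move=> d0 h u.
have q (r : R) : 2 * r * redot (T u) (T u) <=
    d * (redot u u + r ^+ 2 * redot (T u) (T u)).
  have := h (u + r%:C *: T u); have := h (u - r%:C *: T u).
  rewrite !ler_norml => /andP[h1 _] /andP[_ h2].
  move: h1 h2; rewrite linB linD linZ.
  rewrite !(redotDl, redotDr, redotNl, redotNr, redotZl, redotZr).
  rewrite !(redotC _ (T u) u) (symT (T u) u); lra.
have [d00|dn] := eqVneq d 0.
  rewrite d00 expr0n/= mul0r; have := q 1; rewrite d00 mul0r.
  by have := redot_ge0 dot (T u); lra.
have dp : 0 < d by rewrite lt_neqAle eq_sym dn.
have := q d^-1; set N := redot (T u) (T u); set U := redot u u => q1.
have : 2 * d^-1 * N * d <= d * (U + d^-1 ^+ 2 * N) * d by rewrite ler_pM2r.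
have -> : 2 * d^-1 * N * d = 2 * N by field.
have -> : d * (U + d^-1 ^+ 2 * N) * d = d ^+ 2 * U + N by field.
by lra.
Qed.

Lemma psd_CS : (forall x, 0 <= redot (T x) x) ->
  forall x y, redot (T x) y ^+ 2 <= redot (T x) x * redot (T y) y.
Proof.
move=> pos x y; apply: sqr_le_of_quad; rewrite ?pos// => r s.
have := pos (r%:C *: x + s%:C *: y).
rewrite linD !linZ redotDl !redotDr !redotZl !redotZr.
by rewrite (symT y x) (redotC _ y) => h; lra.
Qed.

End Linear.

Lemma bounded_redot T : bounded_operator T ->
  exists2 M : R, 0 <= M & forall x, redot (T x) (T x) <= M ^+ 2 * redot x x.
Proof.
move=> [_ [M hM]]; exists `|M| => // x.
have := hM x; rewrite !(norm_redot hip) -rmorphM/= lecR => h.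
have {}h : Num.sqrt (redot (T x) (T x)) <= `|M| * Num.sqrt (redot x x).
  by apply: (le_trans h); rewrite ler_wpM2r ?sqrtr_ge0// ler_norm.
rewrite -[leLHS]sqr_sqrtr ?redot_ge0// -[X in _ * X]sqr_sqrtr ?redot_ge0//.
by rewrite -exprMn ler_pXn2r// nnegrE ?mulr_ge0 ?sqrtr_ge0.
Qed.

Lemma self_adjoint_redot T : self_adjoint dot T ->
  forall x y, redot (T x) y = redot x (T y).
Proof. by move=> [_ h] x y; rewrite /redot h. Qed.

Lemma positive_redot T : positive_operator dot T ->
  forall x, 0 <= redot (T x) x.
Proof. by move=> [_ h] x; have := h x; rewrite lecE => /andP[]. Qed.

(* An approximate eigenvector x of D = T - S at its extreme value m nearly
   satisfies D x = +-m x, while <D x, (T + S) x> = |T x|^2 - |S x|^2 = 0. *)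
Lemma positive_root_unique T S :
  positive_operator dot T -> positive_operator dot S ->
  (forall x, redot (T x) (T x) = redot (S x) (S x)) -> T = S.
Proof.
move=> pT pS eqTS.
have lT := pT.1.1.1; have lS := pS.1.1.1.
pose D x := T x - S x; pose A x := T x + S x.
have lD : linear D.
  by move=> a x y; rewrite /D lT lS scalerBr opprD addrACA.
have sT := self_adjoint_redot pT.1; have sS := self_adjoint_redot pS.1.
have sD x y : redot (D x) y = redot x (D y).
  by rewrite redotBl redotBr sT sS.
have DA x : redot (D x) (A x) = 0.
  rewrite redotBl !redotDr eqTS (redotC _ (S x) (T x)); lra.
(* Positivity of T and S gives - A <= D <= A as quadratic forms. *)
have DleA x : `|redot (D x) x| <= redot (A x) x.
  rewrite redotBl redotDl ler_norml.
  by have := positive_redot pT x; have := positive_redot pS x; lra.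
have [MT MT0 hT] := bounded_redot pT.1.1.
have [MS MS0 hS] := bounded_redot pS.1.1.
have [b b0 hA] : exists2 b : R, 0 <= b &
    forall x, redot (A x) (A x) <= b ^+ 2 * redot x x.
  exists (2 * (MT + MS)) => [|x]; first by nra.
  apply: (le_trans (redot_normD _ _)).
  have := hT x; have := hS x; have := redot_ge0 dot x.
  set n := redot x x => n0 h1 h2.
  have : 0 <= MT * MS * n by rewrite !mulr_ge0.
  have : 0 <= MT ^+ 2 * n by rewrite mulr_ge0 ?sqr_ge0.
  have : 0 <= MS ^+ 2 * n by rewrite mulr_ge0 ?sqr_ge0.
  by nra.
have DE x : D x = T x - S x by [].
clearbody D A.
pose Q := [set `|redot (D x) x| | x in [set x | redot x x = 1]].
have ubQ : has_ubound Q.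
  exists b => _ [x /= x1 <-]; apply: (le_trans (DleA x)).
  apply: (le_trans (ler_norm _)).
  by rewrite -[b]mulr1 (redot_le_norm (dot := dot))// ?x1 ?expr1n// -[b ^+ 2]mulr1 -x1 hA.
suff D0 w : D w = 0 by apply/funext => x; apply/eqP; rewrite -subr_eq0 -DE; apply/eqP/D0.
pose m := sup Q.
have mbound y : `|redot (D y) y| <= m * redot y y.
  have [->|y0] := eqVneq y 0; first by rewrite !redot0r normr0 mulr0.
  have n0 : 0 < redot y y by rewrite lt_neqAle redot_ge0 eq_sym redot_eq0 y0.
  pose s := (Num.sqrt (redot y y))^-1.
  have s2 : s * s = (redot y y)^-1.
    by rewrite /s -invfM -expr2 sqr_sqrtr// ltW.
  have : Q (`|redot (D (s%:C *: y)) (s%:C *: y)|).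
    exists (s%:C *: y) => //=.
    by rewrite redotZl redotZr mulrA s2 mulVf// gt_eqF.
  move/(ub_le_sup ubQ); rewrite (linZ lD) redotZl redotZr mulrA s2 normrM.
  by rewrite gtr0_norm ?invr_gt0// mulrC ler_pdivrMr.
suff m0 : m <= 0.
  have h0 y : `|redot (D y) y| <= 0 * redot y y.
    by apply: (le_trans (mbound y)); rewrite ler_wpM2r// redot_ge0.
  have := sym_form_bound lD sD (lexx 0) h0 w.
  by rewrite expr0n/= mul0r => h; apply/eqP; rewrite -(redot_eq0 dot) eq_le h redot_ge0.
rewrite leNgt; apply/negP => m0.
have Dm := sym_form_bound lD sD (ltW m0) mbound.
(* Take a unit vector x whose form value a = <D x, x> satisfies |a| > m - e, and c = m or - m with
   the sign of a. Then |D x - c x|^2 <= 2 m e, while <D x - c x, A x> = - c <x, A x> has size at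
   least m |a|. *)
have key e : 0 < e -> e < m -> m * (m - e) <= b * Num.sqrt (2 * m * e).
  move=> e0 em.
  have hsQ : has_sup Q.
    (* The supremum of the empty set is 0 by convention, so 0 < m also yields a unit vector. *)
    split=> //; apply/set0P; apply/negP => /eqP Q0.
    by move: m0; rewrite /m Q0 sup0 ltxx.
  have [_ [x /= x1 <-] mx] := sup_adherent e0 hsQ.
  pose a := redot (D x) x; rewrite -/m -/a in mx.
  pose c := Num.sg a * m.
  have a0 : a != 0.
    apply/eqP => a0; move: mx; rewrite a0 normr0; lra.
  have sg2 : Num.sg a ^+ 2 = 1 by rewrite sqr_sg a0.
  have sgD : Num.sg a * a = `|a| by rewrite -normrEsg.
  have E1 : redot (D x - c%:C *: x) (D x - c%:C *: x) <= 2 * m * e.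
    rewrite redotBl !redotBr !redotZl !redotZr (redotC _ x (D x)) -/a x1.
    have -> : c * a = m * `|a| by rewrite -sgD /c; ring.
    have -> : c * (c * 1) = m ^+ 2 by rewrite /c mulr1 mulrACA -!expr2 sg2 mul1r.
    have := Dm x; rewrite x1; nra.
  have := redot_le_norm (dot := dot) (sqrtr_ge0 (2 * m * e)) b0.
  move=> /(_ (D x - c%:C *: x) (A x)).
  rewrite sqr_sqrtr; last by rewrite !mulr_ge0 ?ltW.
  move=> /(_ E1); rewrite -{1}[b ^+ 2]mulr1 -x1 => /(_ (hA x)).
  rewrite redotBl DA sub0r normrN redotZl normrM /c normrM.
  rewrite normr_sg a0 mul1r (gtr0_norm m0) (mulrC b).
  apply: le_trans; rewrite ler_pM2l//.
  rewrite redotC (le_trans _ (ler_norm _))// (le_trans _ (DleA x))// -/a; lra.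
(* With this e, squaring [key] gives m^4 / 4 <= 2 b^2 m e <= m^4 / 16, which is absurd. *)
pose e := Num.min (m / 2) (m ^+ 3 / (32 * (b ^+ 2 + 1))).
have den : 0 < 32 * (b ^+ 2 + 1) by nra.
have e0 : 0 < e.
  by rewrite lt_min !divr_gt0// exprn_gt0.
have em : e <= m / 2 by rewrite ge_min lexx.
have e2 : e * (32 * (b ^+ 2 + 1)) <= m ^+ 3.
  by rewrite -ler_pdivlMr// ge_min lexx orbT.
have e3 : e < m by apply: (le_lt_trans em); lra.
have := key e e0 e3.
rewrite -(@ler_pXn2r _ 2)// ?nnegrE ?mulr_ge0 ?sqrtr_ge0 ?subr_ge0 ?(ltW m0)// ?(ltW e3)//.
rewrite !exprMn sqr_sqrtr; last by rewrite !mulr_ge0 ?ltW.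
move=> k1.
have k2 : (m / 2) ^+ 2 <= (m - e) ^+ 2.
  by rewrite ler_pXn2r// ?nnegrE//; lra.
have k3 : m ^+ 2 * (m / 2) ^+ 2 <= b ^+ 2 * (2 * m * e).
  by apply: le_trans k1; rewrite ler_wpM2l// sqr_ge0.
have k4 : m * (e * (32 * (b ^+ 2 + 1))) <= m * m ^+ 3 by rewrite ler_wpM2l// ltW.
have k5 : 0 < m * e by rewrite mulr_gt0.
nra.
Qed.

End SymmetricOperators.

(** * The trace bound *)

Section TraceBound.
Context (R : realType) (H : completeNormedModType R[i]).
Variable dot : {dot H for conjC}.
Hypothesis hip : inner_product dot.
Local Notation redot := (redot dot).

Section FinitePart.
Variable B : set H.
Hypothesis onB : orthonormal_basis dot B.

Definition finite_part (F : seq H) := uniq F /\ (forall f, f \in F -> B f).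

Definition partial_proj (F : seq H) (u : H) : H := \sum_(f <- F) dot u f *: f.

Lemma partial_proj_linear F : linear (partial_proj F).
Proof.
move=> a u v; rewrite /partial_proj scaler_sumr -big_split/=.
by apply: eq_bigr => f _; rewrite dotDl dotZl scalerDl scalerA.
Qed.

Lemma partial_proj_id F f : finite_part F -> f \in F -> partial_proj F f = f.
Proof.
move=> [uF FB] fF; have [nB oB _] := onB.
rewrite /partial_proj (bigD1_seq f)//= nB ?scale1r; last exact: FB.
rewrite big_seq_cond big1 ?addr0// => g /andP[gF gf].
by rewrite oB ?scale0r//; [exact: FB|exact: FB|apply/eqP; rewrite eq_sym].
Qed.

(** Over the reals, the complex line of f splits into the orthogonal directions f and i f, so the
    form of the projection is a real Parseval sum over both. *)
Lemma partial_projE F u v : redot (partial_proj F u) v =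
  \sum_(f <- F) (redot u f * redot v f + redot u ('i *: f) * redot v ('i *: f)).
Proof.
rewrite /partial_proj redot_suml; apply: eq_bigr => f _.
rewrite (redotC _ u ('i *: f)) (redotC _ v ('i *: f)) !redot_i.
rewrite (redotC _ u) (redotC _ v) /redot dotZl (dotC _ u f).
have -> : ((dot f u)^*)%R = conjc (dot f u) by [].
by case: (dot f u) => a b; case: (dot f v) => c d /=; ring.
Qed.

Lemma partial_proj_sym F u v :
  redot (partial_proj F u) v = redot u (partial_proj F v).
Proof.
rewrite (redotC _ u) !partial_projE; apply: eq_bigr => f _; ring.
Qed.

Lemma partial_proj_idem F u : finite_part F ->
  partial_proj F (partial_proj F u) = partial_proj F u.
Proof.
move=> fF; rewrite {2 3}/partial_proj (lin_sum (@partial_proj_linear F)).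
rewrite big_seq [RHS]big_seq; apply: eq_bigr => f /(partial_proj_id fF) ff.
by rewrite (linZ (@partial_proj_linear F)) ff.
Qed.

Lemma partial_proj_compl_le F u : finite_part F ->
  redot (u - partial_proj F u) (u - partial_proj F u) <= redot u u.
Proof.
move=> fF; have := redot_ge0 dot (partial_proj F u).
have PP : redot (partial_proj F u) (partial_proj F u) = redot u (partial_proj F u).
  by rewrite partial_proj_sym partial_proj_idem.
rewrite !(redotBl, redotBr) (redotC _ (partial_proj F u) u) PP; lra.
Qed.

(** The vectors u with this property form a closed subspace containing B, hence all of H.
    Quantifying over all larger families allows the families of two vectors to be merged. *)
Lemma partial_proj_cvg u (e : R) : 0 < e -> exists2 F, finite_part F &
  forall F', finite_part F' -> {subset F <= F'} ->
    redot (u - partial_proj F' u) (u - partial_proj F' u) <= e.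
Proof.
pose M := [set u | forall e : R, 0 < e -> exists2 F, finite_part F &
  forall F', finite_part F' -> {subset F <= F'} ->
    redot (u - partial_proj F' u) (u - partial_proj F' u) <= e].
suff MT : M = setT.
  have Mu : M u by rewrite MT.
  exact: Mu.
rewrite -subTset; have [_ _ <-] := onB.
apply: smallest_sub; last first.
  move=> f Bf {}e e0; exists [:: f]; first by split => // g; rewrite inE => /eqP->.
  move=> F' fF' fF; rewrite partial_proj_id ?subrr ?redot0l ?ltW//.
  by apply: fF; rewrite inE.
have compl_norm F x y : finite_part F ->
    redot (x - partial_proj F x) (x - partial_proj F x) <=
    2 * redot (x - y) (x - y) +
    2 * redot (y - partial_proj F y) (y - partial_proj F y).
  move=> fF; have lP := @partial_proj_linear F.
  have -> : x - partial_proj F x =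
      ((x - y) - partial_proj F (x - y)) + (y - partial_proj F y).
    rewrite (linB lP); move: (partial_proj F x) (partial_proj F y) => p q.
    rewrite opprB [RHS]addrACA.
    by rewrite [x - y + y]subrK [q - p - q]addrAC subrr add0r.
  apply: (le_trans (redot_normD _ _ _)); rewrite lerD2r ler_pM2l//.
  exact: partial_proj_compl_le.
split.
- apply: (closed_of_approx hip) => v hv {}e e0.
  have [|w Mw vw] := hv (e / 4); first by rewrite divr_gt0.
  have [|F fF FP] := Mw (e / 4); first by rewrite divr_gt0.
  exists F => // F' fF' FF'; apply: (le_trans (compl_norm F' v w fF')).
  by have := FP F' fF' FF'; lra.
- move=> {}e e0; exists [::] => // F' _ _.
  by rewrite (lin0 (@partial_proj_linear F')) subrr redot0l ltW.
- move=> a x y Mx My {}e e0.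
  pose k := Re `|a|.
  have ka : `|a| = k%:C by rewrite RRe_real ?normr_real.
  have aE z : redot (a *: z) (a *: z) = (k ^+ 2) * redot z z.
    apply: (@complexI R); rewrite rmorphM rmorphXn/= -!dot_redot.
    by rewrite dnormZ ka.
  (* After scaling by a, whose modulus is k, this error is at most e / 4; [redot_normD] then doubles
     each of the two errors. The + 1 covers k = 0. *)
  have [|F fF FP] := Mx (e / (4 * (k ^+ 2 + 1))).
    by rewrite divr_gt0// mulr_gt0// ltr_wpDl// sqr_ge0.
  have [|G fG GP] := My (e / 4); first by rewrite divr_gt0.
  exists (undup (F ++ G)).
    split=> [|f]; first exact: undup_uniq.
    by rewrite mem_undup mem_cat => /orP[/fF.2|/fG.2].
  move=> F' fF' FF'.
  have FF : {subset F <= F'}.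
    by move=> f fF0; apply: FF'; rewrite mem_undup mem_cat fF0.
  have GF : {subset G <= F'}.
    by move=> f fF0; apply: FF'; rewrite mem_undup mem_cat fF0 orbT.
  have lP := @partial_proj_linear F'.
  have -> : a *: x + y - partial_proj F' (a *: x + y) =
      a *: (x - partial_proj F' x) + (y - partial_proj F' y).
    by rewrite lP scalerBr opprD addrACA.
  apply: (le_trans (redot_normD _ _ _)); rewrite aE.
  have := GP F' fF' GF; have := FP F' fF' FF.
  set r1 := redot _ _ => h1; set r2 := redot _ _ => h2.
  have kp : 0 < k ^+ 2 + 1 by rewrite ltr_wpDl// sqr_ge0.
  have r10 : 0 <= r1 by exact: redot_ge0.
  have : (k ^+ 2 + 1) * r1 <= e / 4.
    rewrite mulrC -ler_pdivlMr//; apply: (le_trans h1).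
    by rewrite invfM mulrA.
  nra.
Qed.

Lemma partial_proj_cvg_seq n (g : nat -> H) (e : R) : 0 < e ->
  exists2 F, finite_part F & forall i, (i < n)%N ->
    redot (g i - partial_proj F (g i)) (g i - partial_proj F (g i)) <= e.
Proof.
move=> e0; suff [F fF FP] : exists2 F, finite_part F &
  forall F', finite_part F' -> {subset F <= F'} -> forall i, (i < n)%N ->
    redot (g i - partial_proj F' (g i)) (g i - partial_proj F' (g i)) <= e.
  by exists F => // i ni; apply: FP.
elim: n => [|n [F fF FP]]; first by exists [::].
have [G fG GP] := partial_proj_cvg (g n) e0.
exists (undup (F ++ G)).
  split=> [|f]; first exact: undup_uniq.
  by rewrite mem_undup mem_cat => /orP[/fF.2|/fG.2].
move=> F' fF' FF' i; rewrite ltnS leq_eqVlt => /predU1P[->|ni].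
  by apply: GP => // f fG0; apply: FF'; rewrite mem_undup mem_cat fG0 orbT.
by apply: FP => // f fF0; apply: FF'; rewrite mem_undup mem_cat fF0.
Qed.

End FinitePart.

(* Expanding <K (f - P f), f - P f> >= 0 with P f = sum_i <f, g_i> g_i and
   summing over the real orthonormal family {f, i f : f in B} gives
   0 <= 2 tr K - 2 sum_i <K g_i, g_i> + sum_i |g_i|^2 <K g_i, g_i>. *)
Lemma trace_bound K : positive_operator dot K -> trace_class dot K ->
  exists C : R, forall n (g : nat -> H),
    (forall i j, (i < n)%N -> (j < n)%N -> i != j -> redot (g i) (g j) = 0) ->
    (forall i, (i < n)%N -> redot (g i) (g i) <= 1) ->
    \sum_(i < n) redot (K (g i)) (g i) <= C.
Proof.
move=> pK [bK [L [B [[pL LK] onB Bfin]]]].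
(* A positive operator is its own modulus, so the finite sum in [trace_class] is the trace of K
   itself. *)
have KL : L = K.
  apply: (positive_root_unique hip pL pK) => x.
  by rewrite -(self_adjoint_redot pL.1) /redot LK.
rewrite {L}KL in pL LK Bfin.
have lK := bK.1; have sK := self_adjoint_redot pK.1.
have pKr := positive_redot pK.
pose S := \esum_(e in B) (redot (K e) e)%:E.
have S0 : (0 <= S)%E by apply: esum_ge0 => x _; rewrite lee_fin pKr.
have [C SC] : exists C, S = C%:E.
  by exists (fine S); rewrite fineK// ge0_fin_numE.
have FC F : finite_part B F -> \sum_(f <- F) redot (K f) f <= C.
  move=> [uF FB]; rewrite -lee_fin -SC.
  apply: esum_ge; exists [set` F]; last by rewrite -fsbig_seq// sumEFin.
  by split; [exact: finite_seq|exact: FB].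
have [M M0 hM] := bounded_redot hip bK.
(* The factor 2 arises because the real family of all f and i f counts the trace twice. *)
exists (2 * C) => n g og ng.
(* A single constant bounding the norms of both [g i] and [K (g i)]. *)
pose V := M + 1.
have V0 : 0 < V by rewrite ltr_wpDl.
have gV i : (i < n)%N -> redot (g i) (g i) <= V ^+ 2.
  by move=> ni; apply: (le_trans (ng i ni)); rewrite /V; nra.
have KgV i : (i < n)%N -> redot (K (g i)) (K (g i)) <= V ^+ 2.
  move=> ni; apply: (le_trans (hM _)); apply: (@le_trans _ _ (M ^+ 2 * 1)).
    by rewrite ler_wpM2l ?sqr_ge0// ng.
  by rewrite /V; nra.
set T := \sum_(i < n) _.
have key e : 0 < e -> T <= 2 * C + e * (2 * n%:R * V + (n * n)%:R * V * V ^+ 2).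
  move=> e0.
  have [F fF FP] := partial_proj_cvg_seq onB n g (exprn_gt0 2 e0).
  pose P := partial_proj F.
  have err i v : (i < n)%N -> redot v v <= V ^+ 2 ->
      `|redot (P (g i)) v - redot (g i) v| <= e * V.
    move=> ni hv; rewrite -redotBl -normrN -redotNl opprB.
    by apply: redot_le_norm hv; rewrite ?(ltW e0) ?(ltW V0)// FP.
  (* [P] is the projection onto the finite family F, while [Q f] is the sum of the <f, g_i> g_i, and
     [q f] is the expansion of <K (f - Q f), f - Q f>. Summing q over the real family turns products
     of coordinates into pairings with [P (g i)], which is within e of [g i]. *)
  pose Q f := \sum_(i < n) (redot f (g i))%:C *: g i.
  pose q f := redot (K f) f
    - 2 * (\sum_(i < n) redot f (g i) * redot f (K (g i)))
    + \sum_(i < n) \sum_(j < n) redot f (g i) * redot f (g j) * redot (K (g i)) (g j).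
  have q_ge0 f : 0 <= q f.
    rewrite /q; have := pKr (f - Q f).
    rewrite (linB lK) !(redotBl, redotBr).
    have -> : redot (K f) (Q f) = \sum_(i < n) redot f (g i) * redot f (K (g i)).
      rewrite redot_sumr; apply: eq_bigr => i _.
      by rewrite redotZr sK.
    have -> : redot (K (Q f)) f = \sum_(i < n) redot f (g i) * redot f (K (g i)).
      rewrite (lin_sum lK) redot_suml; apply: eq_bigr => i _.
      by rewrite (linZ lK) redotZl (redotC _ f (K _)).
    have -> : redot (K (Q f)) (Q f) =
       \sum_(i < n) \sum_(j < n) redot f (g i) * redot f (g j) * redot (K (g i)) (g j).
      rewrite (lin_sum lK) redot_suml; apply: eq_bigr => i _.
      rewrite (linZ lK) redotZl redot_sumr mulr_sumr; apply: eq_bigr => j _.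
      by rewrite redotZr mulrA.
    by lra.
  have Ki f : redot (K ('i *: f)) ('i *: f) = redot (K f) f.
    rewrite (linZ lK) /redot dotZl dotZr mulrA -normCK.
    have -> : `|'i : R[i]| = 1.
      by rewrite complexiE normCi.
    by rewrite expr1n mul1r.
  have : 0 <= \sum_(f <- F) (q f + q ('i *: f)).
    by apply: sumr_ge0 => f _; rewrite addr_ge0// q_ge0.
  have -> : \sum_(f <- F) (q f + q ('i *: f))
    = 2 * (\sum_(f <- F) redot (K f) f)
      - 2 * (\sum_(i < n) redot (P (g i)) (K (g i)))
      + \sum_(i < n) \sum_(j < n) redot (P (g i)) (g j) * redot (K (g i)) (g j).
    have -> : \sum_(i < n) redot (P (g i)) (K (g i)) = \sum_(f <- F)
       (\sum_(i < n) redot f (g i) * redot f (K (g i)) +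
        \sum_(i < n) redot ('i *: f) (g i) * redot ('i *: f) (K (g i))).
      under eq_bigr do rewrite partial_projE.
      rewrite exchange_big/=; apply: eq_bigr => f _.
      rewrite big_split/=; congr (_ + _); apply: eq_bigr => i _.
        by rewrite !(redotC _ _ f).
      by rewrite !(redotC _ _ ('i *: f)).
    have -> : \sum_(i < n) \sum_(j < n) redot (P (g i)) (g j) * redot (K (g i)) (g j) =
       \sum_(f <- F) (\sum_(i < n) \sum_(j < n) redot f (g i) * redot f (g j) * redot (K (g i)) (g j)
        + \sum_(i < n) \sum_(j < n) redot ('i *: f) (g i) * redot ('i *: f) (g j) * redot (K (g i)) (g j)).
      under [RHS]eq_bigr do rewrite -big_split/=.
      rewrite [RHS]exchange_big/=; apply: eq_bigr => i _.
      under [RHS]eq_bigr do rewrite -big_split/=.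
      rewrite [RHS]exchange_big/=; apply: eq_bigr => j _.
      rewrite partial_projE mulr_suml; apply: eq_bigr => f _.
      by rewrite !(redotC _ _ f) !(redotC _ _ ('i *: f)) mulrDl.
    rewrite !mulr_sumr -!sumrB -big_split/=; apply: eq_bigr => f _.
    by rewrite /q Ki; ring.
  have E1 : T - n%:R * (e * V) <= \sum_(i < n) redot (P (g i)) (K (g i)).
    have -> : n%:R * (e * V) = \sum_(i < n) (e * V).
      by rewrite sumr_const card_ord mulr_natl.
    rewrite /T -sumrB; apply: ler_sum => i _.
    have := err i _ (ltn_ord i) (KgV i (ltn_ord i)).
    rewrite ler_norml sK => /andP[h _]; lra.
  have E2 : \sum_(i < n) \sum_(j < n) redot (P (g i)) (g j) * redot (K (g i)) (g j)
     <= T + (n * n)%:R * (e * V * V ^+ 2).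
    have -> : (n * n)%:R * (e * V * V ^+ 2) = \sum_(i < n) \sum_(j < n) (e * V * V ^+ 2).
      by rewrite !sumr_const !card_ord -mulrnA mulr_natl.
    rewrite /T -big_split/=; apply: ler_sum => i _.
    have hT : \sum_(j < n) redot (g i) (g j) * redot (K (g i)) (g j) <= redot (K (g i)) (g i).
      rewrite (bigD1 i)//= big1 ?addr0; last first.
        by move=> j ji; rewrite og ?mul0r// eq_sym.
      by rewrite ler_piMl// ng.
    apply: le_trans (_ : _ <= \sum_(j < n) (redot (g i) (g j) * redot (K (g i)) (g j) + e * V * V ^+ 2)) _; last first.
      by rewrite big_split/= lerD2r.
    apply: ler_sum => j _.
    rewrite -lerBlDl -mulrBl (le_trans (ler_norm _))// normrM.
    rewrite ler_pM//; first by apply: err => //; exact: gV.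
    have -> : V ^+ 2 = V * V by rewrite expr2.
    exact: redot_le_norm (ltW V0) (ltW V0) (KgV i (ltn_ord i)) (gV j (ltn_ord j)).
  have := FC F fF.
  by rewrite -/P; move: E1 E2; lra.
apply/ler_addgt0Pr => e e0.
pose W := 2 * n%:R * V + (n * n)%:R * V * V ^+ 2.
have W0 : 0 <= W by rewrite addr_ge0// !mulr_ge0// ?exprn_ge0// ltW.
have W1 : 0 < W + 1 by rewrite ltr_wpDl.
apply: (le_trans (key (e / (W + 1)) _)); first by rewrite divr_gt0.
rewrite lerD2l -/W mulrAC ler_pdivrMr// ler_pM2l//; lra.
Qed.

End TraceBound.

(** * Spectral measures and localization *)

Section RawIntegral.
Context d (T : measurableType d) (R : realType).

Import HBNNSimple.

(** Integrals of simple functions evaluate the set function at measurable preimages only. This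
    transfers integrals from [scalar_spectral_measure], which is arbitrary on nonmeasurable sets, to
    a genuine measure. *)
Lemma eq_raw_integral (m1 m2 : set T -> \bar R) (D : set T) (f : T -> \bar R) :
  (forall B, measurable B -> m1 B = m2 B) ->
  integral m1 D f = integral m2 D f.
Proof.
move=> m12; rewrite /integral.
have E (h : {nnsfun T >-> R}) : sintegral m1 h = sintegral m2 h.
  by rewrite /sintegral; apply: eq_fsbigr => x _; rewrite m12.
by congr (ereal_sup _ - ereal_sup _)%E; apply: eq_imagel => h _; rewrite E.
Qed.

End RawIntegral.

Section SpectralMeasure.
Context (R : realType) (H : completeNormedModType R[i]).
Variable dot : {dot H for conjC}.
Hypothesis hip : inner_product dot.
Local Notation redot := (redot dot).

Lemma redot_cvg (u : nat -> H) (l x : H) :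
  u @ \oo --> l -> (fun n => redot (u n) x) @ \oo --> redot l x.
Proof.
move=> ul; apply/cvgrPdist_le => e e0.
have c0 : 0 < Num.sqrt (redot x x) + 1 by rewrite ltr_wpDl ?sqrtr_ge0.
have ec : 0 < e / (Num.sqrt (redot x x) + 1) by rewrite divr_gt0.
have := ul; move/cvgrPdist_le => /(_ (e / (Num.sqrt (redot x x) + 1))%:C).
rewrite ltcR => /(_ ec).
apply: filterS => n; rewrite (le_norm_sqr hip) ?(ltW ec)// => h.
rewrite -redotBl.
apply: (le_trans (redot_le_norm (ltW ec) (sqrtr_ge0 (redot x x)) h _)).
  by rewrite sqr_sqrtr// redot_ge0.
rewrite mulrAC ler_pdivrMr// ler_pM2l//; lra.
Qed.

Section PVM.
Variable E : set (measurableTypeR R) -> H -> H.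
Hypothesis pE : projection_valued_measure dot E.

Lemma pvm_linear B : measurable B -> linear (E B).
Proof. by move=> mB; have [[[]]] := pvm_projection pE mB. Qed.

Lemma pvm_sym B x y : measurable B -> redot (E B x) y = redot x (E B y).
Proof. by move=> mB; apply: self_adjoint_redot; have [] := pvm_projection pE mB. Qed.

Lemma pvm_comp B C x : measurable B -> measurable C ->
  E B (E C x) = E (B `&` C) x.
Proof. by move=> mB mC; rewrite (pvm_setI pE). Qed.

Lemma pvm_redot B C x y : measurable B -> measurable C ->
  redot (E B x) (E C y) = redot (E (B `&` C) x) y.
Proof. by move=> mB mC; rewrite -pvm_sym// pvm_comp// setIC. Qed.

Lemma pvm_redot_id B x : measurable B ->
  redot (E B x) (E B x) = redot (E B x) x.
Proof. by move=> mB; rewrite pvm_redot// setIid. Qed.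

(** Put r = |E(set0) x|^2. Sigma-additivity on the constant sequence of empty sets makes n r
    converge to r, so r = 0. *)
Lemma pvm_set0 x : E set0 x = 0.
Proof.
have m0 : measurable (@set0 (measurableTypeR R)) by exact: measurable0.
have := @pvm_sigma_additive _ _ _ _ pE (fun=> set0) (fun=> m0).
have t0 : trivIset [set: nat] (fun=> @set0 (measurableTypeR R)).
  by apply/trivIsetP => i j _ _ _; rewrite set0I.
rewrite bigcup0// => /(_ t0 x)/redot_cvg-/(_ (E set0 x)).
set r := redot _ _ => cv; apply/eqP; rewrite -(redot_eq0 dot) -/r eq_le redot_ge0 andbT.
rewrite leNgt; apply/negP => r0.
have r2 : 0 < r / 2 by rewrite divr_gt0.
have /cvgrPdist_le/(_ _ r2)[N _ /(_ N.+2)] := cv.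
rewrite /= redot_suml sumr_const card_ord -/r => /(_ (leqW (leqnSn N))).
rewrite ler_norml => /andP[+ _]; rewrite mulrSr mulrSr.
have : 0 <= r *+ N by rewrite mulrn_wge0// ltW.
by lra.
Qed.

Lemma pvm_le B x : measurable B -> redot (E B x) (E B x) <= redot x x.
Proof.
move=> mB; have := redot_ge0 dot (x - E B x).
rewrite !(redotBl, redotBr) (redotC _ x) pvm_redot_id//; lra.
Qed.

(* Truncated because [E] is unconstrained on nonmeasurable sets, while the
   measure structure requires nonnegativity everywhere. *)
Definition spectral_measure (x : H) (B : set (measurableTypeR R)) : \bar R :=
  if `[< measurable B >] then scalar_spectral_measure dot E x B else 0%E.

Lemma spectral_measureE x B : measurable B ->
  spectral_measure x B = (redot (E B x) x)%:E.
Proof. by move=> mB; rewrite /spectral_measure asboolT. Qed.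

Let spectral_measure0 x : spectral_measure x set0 = 0%E.
Proof. by rewrite spectral_measureE// pvm_set0 redot0l. Qed.

Let spectral_measure_ge0 x B : (0 <= spectral_measure x B)%E.
Proof.
rewrite /spectral_measure; case: asboolP => // mB.
by rewrite lee_fin -/(redot _ _) -pvm_redot_id// redot_ge0.
Qed.

Let spectral_measure_sigma_additive x : semi_sigma_additive (spectral_measure x).
Proof.
move=> F mF tF mUF; rewrite spectral_measureE//.
have -> : (fun n => (\sum_(0 <= i < n) spectral_measure x (F i))%E) =
    EFin \o (fun n => redot (\sum_(k < n) E (F k) x) x).
  apply/funext => n /=; rewrite redot_suml big_mkord -sumEFin.
  by apply: eq_bigr => i _; rewrite spectral_measureE.
apply: cvg_EFin; first by near=> n.
by apply: redot_cvg; exact: (pvm_sigma_additive pE).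
Unshelve. all: by end_near. Qed.

HB.instance Definition _ x := isMeasure.Build _ _ _ (spectral_measure x)
  (spectral_measure0 x) (spectral_measure_ge0 x)
  (@spectral_measure_sigma_additive x).

(** The squared norm of the difference of the two sides expands into values of the scalar spectral
    measure of x, and additivity of that measure makes it vanish. *)
Lemma pvm_setU B C x : measurable B -> measurable C -> B `&` C = set0 ->
  E (B `|` C) x = E B x + E C x.
Proof.
move=> mB mC BC; have mU : measurable (B `|` C) by exact: measurableU.
have := @measureU _ _ _ (spectral_measure x) B C mB mC BC.
rewrite /= !spectral_measureE// -EFinD => -[h].
apply/eqP; rewrite -subr_eq0 -(redot_eq0 dot).
rewrite !(redotBl, redotBr, redotDl, redotDr) !pvm_redot//.
have UB : (B `|` C) `&` B = B by rewrite setIUl setIid setIC BC setU0.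
have UC : (B `|` C) `&` C = C by rewrite setIUl setIid BC set0U.
rewrite (setIC C B) BC (setIC B (B `|` C)) (setIC C (B `|` C)) UB UC !setIid.
by rewrite pvm_set0 redot0l h; apply/eqP; ring.
Qed.

Variable A : H -> H.
Hypothesis rA : spectral_resolution dot A E.
Hypothesis lA : linear A.
Hypothesis sA : forall x y, redot (A x) y = redot x (A y).

Let integrable_id x : (spectral_measure x).-integrable setT EFin.
Proof.
have [ix _] := rA.2 x; move: ix; rewrite integrable.unlock => /asboolP[mf fi].
apply/asboolP; split => //.
rewrite (@eq_raw_integral _ _ _ _ (scalar_spectral_measure dot E x))// => B mB.
exact: spectral_measureE.
Qed.

Let form_integral x :
  redot (A x) x = fine (\int[spectral_measure x]_l l%:E)%E.
Proof.
rewrite /redot (rA.2 x).2 /=; congr fine.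
by apply: eq_raw_integral => B mB; rewrite spectral_measureE.
Qed.

(** The spectral measure of E(I) x vanishes off I and agrees with that of x on subsets of I. *)
Lemma form_restrict x (I : set (measurableTypeR R)) : measurable I ->
  redot (A (E I x)) (E I x) = fine (\int[spectral_measure x]_(l in I) l%:E)%E.
Proof.
move=> mI; rewrite form_integral; congr fine.
have mCI : measurable (~` I) by exact: measurableC.
rewrite (negligible_integral mCI measurableT (integrable_id _)); last first.
  by rewrite [LHS]spectral_measureE// pvm_comp// setICl pvm_set0 redot0l.
rewrite setTD setCK; apply: eq_measure_integral => B mB BI.
rewrite [LHS]spectral_measureE// [RHS]spectral_measureE//; congr (_%:E).
by rewrite pvm_comp// (setIidl BI) pvm_redot// (setIidl BI).
Qed.

Let integrable_on x I : measurable I -> (spectral_measure x).-integrable I EFin.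
Proof. by move=> mI; apply: integrableS (integrable_id x). Qed.

Lemma form_bounds x (I : set (measurableTypeR R)) (a b : R) : measurable I ->
  I `<=` [set l | a <= l <= b] ->
  a * redot (E I x) (E I x) <= redot (A (E I x)) (E I x) <=
  b * redot (E I x) (E I x).
Proof.
move=> mI Iab; rewrite form_restrict// pvm_redot_id//.
have ic (c : R) : (spectral_measure x).-integrable I (EFin \o cst c).
  apply: measurable_bounded_integrable => //; last exact: bounded_cst.
  by rewrite [X in (X < _)%E]spectral_measureE// ltry.
have cE (c : R) : (c * redot (E I x) x)%:E = (\int[spectral_measure x]_(l in I) (cst c l)%:E)%E.
  by rewrite (integral_cst (spectral_measure x) mI c%:E) /= spectral_measureE.
have ifin := integrable_fin_num mI (integrable_on x mI).
apply/andP; split; rewrite -lee_fin fineK// cE.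
  apply: (le_integral mI (ic a) (integrable_on x mI)) => l /set_mem /Iab /= /andP[al _].
  by rewrite lee_fin.
apply: (le_integral mI (integrable_on x mI) (ic b)) => l /set_mem /Iab /= /andP[_ lb].
by rewrite lee_fin.
Qed.

Lemma form_split x (I : set (measurableTypeR R)) : measurable I ->
  redot (A x) x = redot (A (E I x)) (E I x) + redot (A (E (~` I) x)) (E (~` I) x).
Proof.
move=> mI; have mCI : measurable (~` I) by exact: measurableC.
rewrite form_integral !form_restrict// -fineD; last 2 first.
- exact: integrable_fin_num (integrable_on x mI).
- exact: integrable_fin_num (integrable_on x mCI).
have /integrableP[mf _] := integrable_id x.
congr fine; rewrite -(setUv I) in mf *; apply: integral_setU => //.
by apply/disj_setPS; rewrite setICr.
Qed.

(** The resolution only gives the diagonal of the form of A. Splitting it at E(I) x + E(~I) y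
    leaves, by symmetry of A, twice this cross term equal to 0. *)
Lemma form_offdiag x y (I : set (measurableTypeR R)) : measurable I ->
  redot (A (E I x)) (E (~` I) y) = 0.
Proof.
move=> mI; have mCI : measurable (~` I) by exact: measurableC.
have := form_split (E I x + E (~` I) y) mI.
rewrite !(linD (pvm_linear mI)) !(linD (pvm_linear mCI)) !pvm_comp//.
rewrite setICr setICl !pvm_set0 !setIid addr0 add0r (linD lA).
rewrite !(redotDl, redotDr) (sA (E (~` I) y)) (redotC _ (E (~` I) y)); lra.
Qed.

(* E(I) reduces A, so the quadratic form bounds the norm of A - a on Ran E(I). *)
Lemma spectral_localization x (I : set (measurableTypeR R)) (a d : R) :
  measurable I -> 0 <= d -> I `<=` [set l | a <= l <= a + d] ->
  redot (A (E I x) - a%:C *: E I x) (A (E I x) - a%:C *: E I x) <=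
  d ^+ 2 * redot (E I x) (E I x).
Proof.
move=> mI d0 Iad; have mCI : measurable (~` I) by exact: measurableC.
have lE := pvm_linear mI.
(* Ran E(I) is A-invariant because the off-diagonal form vanishes; this is what makes [T] below
   symmetric on the whole space. *)
have EA z : E I (A (E I z)) = A (E I z).
  have -> : A (E I z) = E I (A (E I z)) + E (~` I) (A (E I z)).
    by rewrite -pvm_setU// ?setICr// setUv (pvm_setT pE).
  rewrite (_ : E (~` I) _ = 0).
    by rewrite addr0 pvm_comp// setIid.
  by apply: (redot_norm_le (dot := dot)) => w; rewrite pvm_sym// form_offdiag.
pose T y := A (E I y) - a%:C *: E I y.
have lT : linear T.
  move=> c u v; rewrite /T lE lA !scalerBr !scalerDr !scalerA (mulrC c).
  by rewrite opprD addrACA.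
have sT u v : redot (T u) v = redot u (T v).
  rewrite /T redotBl redotBr redotZl redotZr pvm_sym//; congr (_ - _).
  by rewrite -{1}EA pvm_sym// sA pvm_sym// EA.
have bT u : `|redot (T u) u| <= d * redot u u.
  have -> : redot (T u) u = redot (A (E I u)) (E I u) - a * redot (E I u) (E I u).
    rewrite /T redotBl redotZl; congr (_ - _ * _); last by rewrite pvm_redot_id.
    by rewrite -{1}EA pvm_sym.
  have /andP[h1 h2] := form_bounds u mI Iad.
  rewrite ger0_norm ?subr_ge0//.
  apply: (@le_trans _ _ (d * redot (E I u) (E I u))); first by lra.
  by rewrite ler_wpM2l// pvm_le.
have := sym_form_bound lT sT d0 bT (E I x).
by rewrite /T pvm_comp// setIid.
Qed.

End PVM.

End SpectralMeasure.

(** * Dyadic cells and null sets *)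

Section DyadicCells.
Context (R : realType).
Local Notation T := (measurableTypeR R).

Definition mesh (L : nat) : R := 2^-1 ^+ L.

Lemma mesh_gt0 L : 0 < mesh L.
Proof. by rewrite exprn_gt0// invr_gt0. Qed.

Lemma meshS L : mesh L = 2 * mesh L.+1.
Proof. by rewrite /mesh exprS mulrA divff ?mul1r// pnatr_eq0. Qed.

Lemma mesh_small (e : R) : 0 < e -> exists L0, forall L, (L0 <= L)%N -> mesh L < e.
Proof.
move=> e0; have : (fun L => mesh L) @ \oo --> (0 : R).
  by apply: cvg_expr; rewrite gtr0_norm ?invr_gt0// invf_lt1// ltr1n.
move/cvgrPdist_lt => /(_ e e0)[L0 _ h]; exists L0 => L /h.
by rewrite sub0r normrN gtr0_norm// mesh_gt0.
Qed.

Variable M : nat.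

Definition dyad (L i : nat) : R := i%:R * mesh L - M%:R.

Definition cell (L i : nat) : set T := `[dyad L i, dyad L i.+1[%classic.

(** The cells of index below this number tile [window]; those of larger index lie to its right. *)
Definition ncells (L : nat) : nat := (2 * M * 2 ^ L)%N.

Lemma cellE L i x : cell L i x = (dyad L i <= x < dyad L i.+1) :> Prop.
Proof. by rewrite /cell /= in_itv. Qed.

Lemma dyadS L i : dyad L i.+1 = dyad L i + mesh L.
Proof. by rewrite /dyad -natr1 mulrDl mul1r addrAC. Qed.

Lemma measurable_cell L i : measurable (cell L i).
Proof. exact: measurable_itv. Qed.

Lemma dyad_double L i : dyad L i = dyad L.+1 (2 * i).
Proof. by rewrite /dyad meshS natrM; congr (_ - _); ring. Qed.

Lemma cell_split L i : cell L i = cell L.+1 (2 * i) `|` cell L.+1 (2 * i).+1.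
Proof.
have m0 := mesh_gt0 L.+1.
apply/seteqP; split => x; rewrite /setU/= !cellE !dyadS (dyad_double L i) (meshS L).
  by move=> /andP[h1 h2]; case: (ltP x (dyad L.+1 (2 * i) + mesh L.+1)) => h3;
    [left|right]; rewrite ?h1 ?h3//=; lra.
by case=> /andP[h1 h2]; apply/andP; split; lra.
Qed.

Lemma cell_disjoint L i j : i != j -> cell L i `&` cell L j = set0.
Proof.
have wl a b : (a < b)%N -> cell L a `&` cell L b = set0.
  move=> ab; apply/seteqP; split => // x [] /=; rewrite !cellE.
  move=> /andP[_ xa] /andP[bx _].
  have : dyad L a.+1 <= dyad L b.
    by rewrite lerD2r ler_wpM2r ?ler_nat// ltW// mesh_gt0.
  by move=> /(lt_le_trans xa)/lt_le_trans/(_ bx); rewrite ltxx.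
by rewrite neq_ltn => /orP[/wl//|/wl]; rewrite setIC.
Qed.

Lemma cell_eq L i j x : cell L i x -> cell L j x -> i = j.
Proof.
move=> xi xj; apply/eqP; apply/negP => /negP /(@cell_disjoint L) ij.
by have : (cell L i `&` cell L j) x by []; rewrite ij.
Qed.

Definition window : set T := `[- M%:R, M%:R[%classic.

Lemma measurable_window : measurable window.
Proof. exact: measurable_itv. Qed.

Lemma window_cell L x : window x -> exists2 i, (i < ncells L)%N & cell L i x.
Proof.
rewrite /window /= in_itv/= => /andP[x1 x2].
have m0 := mesh_gt0 L.
have mE : mesh L * 2 ^+ L = 1 by rewrite -exprMn mulVf ?expr1n// pnatr_eq0.
have z0 : 0 <= (x + M%:R) / mesh L by rewrite divr_ge0 ?(ltW m0)//; lra.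
have /andP[i1 i2] := truncn_itv z0.
exists (truncn ((x + M%:R) / mesh L)).
  rewrite -(@ltr_nat R); apply: (le_lt_trans i1); rewrite ltr_pdivrMr//.
  by rewrite /ncells natrM natrX -mulrA [_ ^+ _ * _]mulrC mE mulr1 natrM; lra.
rewrite cellE /dyad; move: i1 i2; rewrite ler_pdivlMr// ltr_pdivrMr// => i1 i2.
by apply/andP; split; lra.
Qed.

Lemma lebesgue_cell L i : lebesgue_measure (cell L i) = (mesh L)%:E.
Proof.
rewrite lebesgue_measure_itv/= lte_fin dyadS ltrDl mesh_gt0.
by rewrite -EFinD addrAC subrr add0r.
Qed.

Definition dyadic_inner (U : set T) (L : nat) : set T :=
  \bigcup_(i in [set i | (i < ncells L)%N /\ cell L i `<=` U]) cell L i.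

Lemma measurable_dyadic_inner U L : measurable (dyadic_inner U L).
Proof. by apply: bigcup_measurable => i _; exact: measurable_cell. Qed.

Lemma cell_le_ncells L i x : cell L i x -> window x -> (i < ncells L)%N.
Proof. by move=> ix /(window_cell L)[j jn /(cell_eq ix)->]. Qed.

Lemma dyadic_inner_nondecreasing U : {homo dyadic_inner U : L L' / (L <= L')%N >-> L `<=` L'}.
Proof.
have st L : dyadic_inner U L `<=` dyadic_inner U L.+1.
  move=> x [i [/= iN iU] ix]; move: (ix); rewrite cell_split => -[] xj.
    exists (2 * i)%N => //=; split; first by move: iN; rewrite /ncells expnS; lia.
    by apply: subset_trans iU; rewrite (cell_split L); exact: subsetUl.
  exists (2 * i).+1 => //=; split; first by move: iN; rewrite /ncells expnS; lia.
  by apply: subset_trans iU; rewrite (cell_split L); exact: subsetUr.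
move=> L L'; elim: L' => [|L' IH]; first by rewrite leqn0 => /eqP->.
by rewrite leq_eqVlt => /predU1P[->//|/IH h]; apply: subset_trans (st L').
Qed.

Lemma dyadic_inner_cover (U : set R) : open U -> U `&` window `<=` \bigcup_L dyadic_inner U L.
Proof.
move=> oU x [Ux wx]; have /nbhs_ballP[e /= e0 eU] := open_nbhs_nbhs (conj oU Ux).
have [L /(_ L (leqnn L)) Le] := mesh_small e0.
have [i iN ix] := window_cell L wx.
exists L => //; exists i => //=; split => // y; move: ix.
rewrite !cellE dyadS => /andP[h1 h2] /andP[h3 h4]; apply: eU.
by rewrite -ball_normE/= ltr_norml; apply/andP; split; lra.
Qed.

Lemma dyadic_inner_count (U : set T) L : measurable U ->
  ((\sum_(i < ncells L) if `[< cell L i `<=` U >] then mesh L else 0)%:E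
     <= lebesgue_measure U)%E.
Proof.
move=> mU; rewrite -sumEFin.
pose F (i : 'I_(ncells L)) : set T := if `[< cell L i `<=` U >] then cell L i else set0.
have mF i : measurable (F i) by rewrite /F; case: ifP => _ //; exact: measurable_cell.
have tF : trivIset setT F.
  apply/trivIsetP => i j _ _ ij; rewrite /F.
  case: ifP => _; rewrite ?set0I//; case: ifP => _; rewrite ?setI0//.
  exact: cell_disjoint.
rewrite (eq_bigr (fun i => lebesgue_measure (F i))); last first.
  move=> i _; rewrite /F; case: ifP => _; last by rewrite measure0.
  by rewrite lebesgue_cell.
rewrite -(measure_bigsetU_ord lebesgue_measure)//.
apply: le_measure; rewrite ?inE//; first by apply: bigsetU_measurable.
apply: (big_ind (fun S => S `<=` U)) => // [A B AU BU x [/AU|/BU]//|i _].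
by rewrite /F; case: asboolP => // _ x [].
Qed.

End DyadicCells.

(** * Thin sets carrying a singular measure, and domination by that measure *)

Section MeasureTheory.
Context (R : realType).
Local Notation T := (measurableTypeR R).

(** A covering condition: every cell that meets C counts with its full length. It is asked at
    infinitely many levels rather than at all large ones, as suits a countable intersection of
    unions of cells. *)
Definition thin (M : nat) (C : set T) : Prop :=
  forall (e : R) L0, 0 < e -> exists2 L, (L0 <= L)%N &
    \sum_(i < ncells M L) (if `[< C `&` cell M L i = set0 >] then 0 else mesh R L) < e.

(** Cover the Lebesgue-null carrier ~N of [sigma] by open sets U_n of length below 2^-n, replace
    each U_n by finitely many cells of a level L_n >= n inside it, at a loss of [sigma]-mass at most
    eta / 2^(n+1), and intersect over n. *)
Lemma thin_exhaustion (sigma : {finite_measure set T -> \bar R}) (M : nat) (eta : R) :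
  singular_measure sigma -> 0 < eta ->
  exists C : set T, [/\ measurable C, C `<=` window M, thin M C &
    (sigma (window M `\` C) <= eta%:E)%E].
Proof.
move=> [N [mN sN lN]] eta0; pose W : set T := window M.
have mW : measurable W := measurable_window M.
have mCN : measurable (~` N) by exact: measurableC.
have hU n : exists U : set T, [/\ open (U : set R), measurable U, ~` N `<=` U &
    (lebesgue_measure U < (mesh R n)%:E)%E].
  have lD : (lebesgue_measure (~` N) < +oo)%E by rewrite lN.
  have [U [oU NU lU]] := lebesgue_regularity_outer mCN lD (mesh_gt0 R n).
  have mU : measurable (U : set T) by exact: measurable_realfun.open_measurable.
  exists U; split => //.
  rewrite (measureDI lebesgue_measure mU mCN) (setIidr NU).
  by rewrite [X in (_ + X)%E]lN adde0.
have [U UP] := choice hU.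
(* The uncovered part of U_n in the window decreases to the empty set as the level grows, so its
   [sigma]-measure tends to 0. *)
have hL n : exists L, (n <= L)%N /\
    (sigma (U n `&` W `\` dyadic_inner M (U n) L) <= (eta / (2 ^ n.+1)%:R)%:E)%E.
  have [oU mU _ _] := UP n.
  pose F L := U n `&` W `\` dyadic_inner M (U n) L.
  have mF L : measurable (F L).
    by apply: measurableD; [exact: measurableI|exact: measurable_dyadic_inner].
  have F0 : \bigcap_L F L = set0.
    apply/seteqP; split => // x Fx; have [UWx _] := Fx 0%N I.
    by have [L _ iL] := dyadic_inner_cover oU UWx; have [_] := Fx L I.
  have := @nonincreasing_cvg_mu _ _ _ sigma F _ mF.
  rewrite F0 measure0 => cv.
  have e0 : 0 < eta / (2 ^ n.+1)%:R by rewrite divr_gt0// ltr0n expn_gt0.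
  have /fine_cvgP[_ /cvgrPdist_le/(_ _ e0)[L1 _ hL1]] : sigma \o F @ \oo --> (0 : R)%:E.
    apply: cv => //; first by rewrite -ge0_fin_numE ?fin_num_measure.
    move=> L L' LL'; apply/subsetPset; apply: setDS; exact: dyadic_inner_nondecreasing.
  exists (maxn n L1); split; first exact: leq_maxl.
  have := hL1 _ (leq_maxr n L1); rewrite sub0r normrN /= => h.
  have fF : sigma (F (maxn n L1)) \is a fin_num by exact: fin_num_measure.
  by rewrite -(fineK fF) lee_fin (le_trans (ler_norm _)).
have [L LP] := choice hL.
pose C := W `&` \bigcap_n dyadic_inner M (U n) (L n).
have mC : measurable C.
  by apply: measurableI => //; apply: bigcap_measurable => // n _; exact: measurable_dyadic_inner.
exists C; split => //; first exact: subIsetl.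
- move=> e L0 e0; have [n0 hn0] := mesh_small e0.
  pose n := maxn n0 L0; have [nL _] := LP n.
  exists (L n); first exact: leq_trans (leq_maxr _ _) nL.
  have [_ mU _ lU] := UP n.
  rewrite -lte_fin; apply: (@lt_trans _ _ (mesh R n)%:E); last first.
    by rewrite lte_fin hn0// leq_maxl.
  apply: le_lt_trans lU; apply: le_trans (dyadic_inner_count M (L n) mU).
  rewrite lee_fin; apply: ler_sum => i _; case: asboolP => Ci.
    by case: ifP => // _; rewrite ltW// mesh_gt0.
  case: asboolP => // iU; exfalso; apply: iU.
  (* Cells of one level are disjoint, so a cell of level L_n meeting C is one of those chosen inside
     U_n. *)
  have /eqP/set0P[x [[Wx Cx] ix]] := Ci.
  by have [j [_ jU] jx] := Cx n I; rewrite (cell_eq ix jx).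
- pose G n := U n `&` W `\` dyadic_inner M (U n) (L n).
  have mG n : measurable (G n).
    have [_ mU _ _] := UP n.
    by apply: measurableD; [exact: measurableI|exact: measurable_dyadic_inner].
  have sub : W `\` C `<=` N `|` \bigcup_n G n.
    move=> x [Wx nCx]; have [Nx|nNx] := pselect (N x); [by left|right].
    apply: contrapT => nG; apply: nCx; split => // n _.
    apply: contrapT => ni; apply: nG; exists n => //; split => //; split => //.
    by have [_ _ NU _] := UP n; apply: NU.
  have mUG : measurable (\bigcup_n G n) by exact: bigcup_measurable.
  apply: (@le_trans _ _ (sigma (N `|` \bigcup_n G n))).
    apply: le_measure; rewrite ?inE//; first exact: measurableD.
    exact: measurableU.
  apply: (@le_trans _ _ (sigma N + sigma (\bigcup_n G n))%E).
    exact: measureU2.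
  rewrite sN add0e; apply: le_trans (epsilon_trick0 xpredT (ltW eta0)).
  apply: (@le_trans _ _ (\sum_(n <oo) sigma (G n))%E).
    exact: measure_sigma_subadditive.
  by apply: lee_nneseries => [n _ _|n _]; [exact: measure_ge0|have [] := LP n].
Qed.

(** Let P_n be the positive set of a Hahn decomposition of n sigma - mu. The union of the P_n and
    the union of the C_k both carry [sigma], so if mu vanished on every intersection of P_n with
    C_k, the two measures would be mutually singular. *)
Lemma dominated_piece (mu sigma : {finite_measure set T -> \bar R})
    (C : nat -> set T) :
  (forall k, measurable (C k)) ->
  (forall k, (sigma (window k `\` C k) <= (k.+1%:R^-1)%:E)%E) ->
  ~ mutually_singular mu sigma ->
  exists (n k : nat) (S : set T), [/\ measurable S, (0 < mu (S `&` C k))%E &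
    forall B, measurable B -> B `<=` S -> (mu B <= n%:R%:E * sigma B)%E].
Proof.
move=> mC sC nms.
pose nu (n : nat) := cadd (cscale n%:R (charge_of_finite_measure sigma))
  (copp (charge_of_finite_measure mu)).
have hP n : exists P : set T, [/\ measurable P,
    forall B, measurable B -> B `<=` P -> (mu B <= n%:R%:E * sigma B)%E &
    forall B, measurable B -> B `<=` ~` P -> (n%:R%:E * sigma B <= mu B)%E].
  have [P [Q [[mP pP] [mQ nQ] PQ PQ0]]] := Hahn_decomposition (nu n).
  exists P; split => // B mB BP.
    have := pP B mB BP; rewrite /nu /cadd /cscale /copp /= sube_ge0//.
    by rewrite fin_num_measure.
  have BQ : B `<=` Q.
    by move=> x /BP nPx; have : setT x by []; rewrite -PQ => -[].
  have := nQ B mB BQ; rewrite /nu /cadd /cscale /copp /= sube_le0//.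
have [P PP] := choice hP.
have mP n : measurable (P n) by have [] := PP n.
apply: contrapT => nex; apply: nms.
pose UP := \bigcup_n P n; pose UC := \bigcup_k C k.
have mUP : measurable UP by exact: bigcup_measurable.
have mUC : measurable UC by exact: bigcup_measurable.
exists (UP `&` UC); split; first exact: measurableI.
- have -> : UP `&` UC = \bigcup_n \bigcup_k (P n `&` C k).
    apply/seteqP; split => x.
      by move=> [[n _ Pn] [k _ Ck]]; exists n => //; exists k.
    by move=> [n _ [k _ [Pn Ck]]]; split; [exists n|exists k].
  apply/eqP; rewrite eq_le measure_ge0 andbT.
  have mPC n k : measurable (P n `&` C k) by exact: measurableI.
  have mB n : measurable (\bigcup_k (P n `&` C k)) by exact: bigcup_measurable.
  have PC0 n k : mu (P n `&` C k) = 0%E.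
    apply/eqP; rewrite eq_le measure_ge0 andbT leNgt; apply/negP => h.
    by apply: nex; exists n, k, (P n); split => //; have [] := PP n.
  have mBB : measurable (\bigcup_n \bigcup_k (P n `&` C k)).
    exact: bigcup_measurable.
  have := @measure_sigma_subadditive _ _ _ mu _ _ mB mBB (@subset_refl _ _).
  move/le_trans; apply.
  rewrite eseries0// => n _ _; apply/eqP; rewrite eq_le measure_ge0 andbT.
  have := @measure_sigma_subadditive _ _ _ mu _ _ (mPC n) (mB n) (@subset_refl _ _).
  move/le_trans; apply.
  by rewrite eseries0// => k _ _; exact: PC0.
- rewrite setCI; apply/eqP; rewrite eq_le measure_ge0 andbT.
  have mCU : measurable (~` UP) by exact: measurableC.
  have mCUC : measurable (~` UC) by exact: measurableC.
  apply: (@le_trans _ _ (sigma (~` UP) + sigma (~` UC))%E); first exact: measureU2.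
  have -> : sigma (~` UP) = 0%E.
    have fs : sigma (~` UP) \is a fin_num by exact: fin_num_measure.
    have fm : mu setT \is a fin_num by exact: fin_num_measure.
    apply/eqP; rewrite eq_le measure_ge0 andbT -(fineK fs) lee_fin leNgt.
    apply/negP => s0.
    (* Off every P_n, n sigma <= mu holds for all n, and mu is finite. *)
    have hn n : n%:R * fine (sigma (~` UP)) <= fine (mu setT).
      rewrite -lee_fin EFinM !fineK//; have [_ _ h] := PP n.
      apply: le_trans (h _ mCU _) _.
        by apply: subsetC => x Px; exists n.
      by apply: le_measure; rewrite ?inE.
    have [n] := truncnS_gt (fine (mu setT) / fine (sigma (~` UP))).
    have := hn (truncn (fine (mu setT) / fine (sigma (~` UP)))).+1.
    rewrite -ler_pdivlMr// => /le_lt_trans h.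
    by have := h _ (truncnS_gt _); rewrite ltxx.
  rewrite add0e.
  (* These sets increase to ~UC, and the [sigma]-measure of [F k] is at most 1 / (k + 1). *)
  pose F k : set T := window k `\` UC.
  have mF k : measurable (F k) by apply: measurableD => //; exact: measurable_window.
  have UF : ~` UC = \bigcup_k F k.
    apply/seteqP; split => x; last by move=> [k _ []].
    move=> nx; exists (truncn `|x|).+1 => //; split => //.
    have := truncnS_gt `|x|; rewrite ltr_norml => /andP[h1 h2].
    by rewrite /window /= in_itv/= (ltW h1).
  have ndF : nondecreasing_seq F.
    apply/nondecreasing_seqP => k; apply/subsetPset; apply: setSD => x.
    rewrite /window /= !in_itv/= => /andP[h1 h2]; apply/andP.
    by rewrite -natr1; split; lra.
  have cv : sigma \o F @ \oo --> sigma (~` UC).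
    by rewrite UF; apply: nondecreasing_cvg_mu => //; rewrite -UF.
  have cv0 : (fun k => (k.+1%:R^-1 : R)%:E) @ \oo --> (0 : R)%:E.
    by apply: cvg_EFin; [exact: nearW|exact: cvg_harmonic].
  apply: (lee_cvg_to cv cv0); apply: nearW => k /=.
  apply: le_trans (sC k); apply: le_measure; rewrite ?inE//.
    by apply: measurableD => //; exact: measurable_window.
  by apply: setDS => x Cx; exists k.
Qed.

End MeasureTheory.

(** * Weighted forms on cells *)

Section CellForms.
Context (R : realType) (H : completeNormedModType R[i]).
Variable dot : {dot H for conjC}.
Local Notation redot := (redot dot).
Variable M : nat.

Lemma sum_double (V : nmodType) (f : nat -> V) n :
  \sum_(i < 2 * n) f i = \sum_(i < n) (f (2 * i)%N + f (2 * i).+1).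
Proof.
elim: n => [|n IH]; first by rewrite muln0 !big_ord0.
by rewrite mulnS !big_ord_recr/= IH -addrA.
Qed.

Lemma ncellsS L : ncells M L.+1 = (2 * ncells M L)%N.
Proof. by rewrite /ncells expnS; lia. Qed.

Lemma subadditive_cell_sum (f : nat -> nat -> R) :
  (forall L i, f L i <= f L.+1 (2 * i)%N + f L.+1 (2 * i).+1) ->
  forall L L', (L <= L')%N ->
  \sum_(i < ncells M L) f L i <= \sum_(i < ncells M L') f L' i.
Proof.
move=> hf L; elim=> [|L' IH]; first by rewrite leqn0 => /eqP->.
rewrite leq_eqVlt => /predU1P[->//|/IH h]; apply: (le_trans h).
by rewrite ncellsS sum_double; apply: ler_sum => i _.
Qed.

Variable w : nat -> nat -> R.
Hypothesis w_ge0 : forall L i, 0 <= w L i.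
Hypothesis w_split : forall L i, w L i = w L.+1 (2 * i)%N + w L.+1 (2 * i).+1.

(** A vector-valued additive function of the cells that is absolutely continuous with respect to the
    weight w. *)
Definition adapted (g : nat -> nat -> H) : Prop :=
  (forall L i, g L i = g L.+1 (2 * i)%N + g L.+1 (2 * i).+1) /\
  (forall L i, w L i = 0 -> g L i = 0).

Variable K : H -> H.
Hypothesis linK : linear K.
Hypothesis symK : forall x y, redot (K x) y = redot x (K y).
Hypothesis posK : forall x, 0 <= redot (K x) x.

(* Cells of weight 0 contribute 0, since x / 0 = 0. *)
Definition cell_form (L : nat) (g h : nat -> nat -> H) : R :=
  \sum_(i < ncells M L) redot (K (g L i)) (h L i) / w L i.

(** For the halves of one cell this reads <K(a+b), a+b> / (u+v) <= <K a, a> / u + <K b, b> / v,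
    which is positivity of K at v a - u b. A half of weight 0 carries the zero vector. *)
Lemma cell_form_nondecreasing g L L' : adapted g -> (L <= L')%N ->
  cell_form L g g <= cell_form L' g g.
Proof.
move=> [ga g0].
apply: (@subadditive_cell_sum (fun L i => redot (K (g L i)) (g L i) / w L i)).
move=> {}L i; rewrite ga w_split.
have := g0 L.+1 (2 * i)%N; have := g0 L.+1 (2 * i).+1.
have := w_ge0 L.+1 (2 * i)%N; have := w_ge0 L.+1 (2 * i).+1.
move: (g _ _) (g _ _) (w _ _) (w _ _) => a b u v v0 u0 hb ha.
have [vz|vn] := eqVneq v 0.
  by rewrite (hb vz) vz !addr0 invr0 mulr0 addr0.
have [uz|un] := eqVneq u 0.
  by rewrite (ha uz) uz !add0r invr0 mulr0 add0r.
have vp : 0 < v by rewrite lt_neqAle eq_sym vn.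
have up : 0 < u by rewrite lt_neqAle eq_sym un.
have := posK (v%:C *: a - u%:C *: b).
rewrite (linB linK) !(linZ linK) (linD linK).
rewrite !(redotDl, redotDr, redotNl, redotNr, redotZl, redotZr).
rewrite (symK b a) (redotC _ b (K a)).
move: (redot (K a) a) (redot (K a) b) (redot (K b) b) => aa ab bb h.
rewrite -subr_ge0.
have -> : aa / u + bb / v - (aa + ab + (ab + bb)) / (u + v) =
   (v * (v * aa) - u * (v * ab) - v * (u * ab) + u * (u * bb)) / (u * v * (u + v)).
  by field; rewrite !gt_eqF// addr_gt0.
apply: divr_ge0; first by lra.
by rewrite ltW// !mulr_gt0// addr_gt0.
Qed.

Lemma cell_form_polar L g h :
  cell_form L (fun L i => g L i + h L i) (fun L i => g L i + h L i) =
  cell_form L g g + cell_form L h h + 2 * cell_form L g h.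
Proof.
rewrite /cell_form mulr_sumr -!big_split/=; apply: eq_bigr => i _.
rewrite (linD linK) !(redotDl, redotDr) (symK (h L i)) (redotC _ (h L i)).
ring.
Qed.

Lemma cell_form_parallelogram L g h :
  cell_form L (fun L i => g L i + h L i) (fun L i => g L i + h L i) =
  2 * cell_form L g g + 2 * cell_form L h h -
  cell_form L (fun L i => g L i - h L i) (fun L i => g L i - h L i).
Proof.
rewrite /cell_form !mulr_sumr -!big_split/= -sumrB; apply: eq_bigr => i _.
rewrite (linD linK) (linB linK) !(redotDl, redotDr, redotNl, redotNr).
ring.
Qed.

Lemma adaptedD g h : adapted g -> adapted h -> adapted (fun L i => g L i + h L i).
Proof.
move=> [ga g0] [ha h0]; split => L i; first by rewrite ga ha addrACA.
by move=> wz; rewrite g0// h0// addr0.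
Qed.

(** Write e_m for the energy at level m. By monotonicity and the parallelogram law, e_m(g+h) >= 2
    e_n(g) + 2 e_n(h) - d. Expanding the left side, with e_m(g) and e_m(h) at most d above level n,
    leaves 2 B_m(g, h) >= e_n(g) + e_n(h) - 3 d >= 8 d - 3 d. *)
Lemma cell_form_lower (g h : nat -> nat -> H) (n : nat) (d : R) :
  adapted g -> adapted h ->
  (forall m, (n <= m)%N -> cell_form m g g <= cell_form n g g + d) ->
  (forall m, (n <= m)%N -> cell_form m h h <= cell_form n h h + d) ->
  4 * d <= cell_form n g g -> 4 * d <= cell_form n h h ->
  cell_form n (fun L i => g L i - h L i) (fun L i => g L i - h L i) <= d ->
  forall m, (n <= m)%N -> 5 * d <= 2 * cell_form m g h.
Proof.
move=> ag ah hg hh g4 h4 gh m nm.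
have := cell_form_nondecreasing (adaptedD ag ah) nm.
rewrite (cell_form_polar m) (cell_form_parallelogram n).
by have := hg m nm; have := hh m nm; lra.
Qed.

(** A bounded nondecreasing sequence is eventually within any tolerance of its supremum. A tolerance
    of the form 1 / (p + 1) can be recorded by a natural number. *)
Lemma cell_form_stable (g : nat -> nat -> H) (C : R) : adapted g ->
  (forall L, cell_form L g g <= C) ->
  (exists L, 0 < cell_form L g g) ->
  exists n p : nat, 4 * p.+1%:R^-1 <= cell_form n g g /\
    forall m, (n <= m)%N -> cell_form m g g <= cell_form n g g + p.+1%:R^-1.
Proof.
move=> ag hC [L0 q0].
have [p hp] : exists p : nat, 4 * p.+1%:R^-1 <= cell_form L0 g g.
  exists (truncn (4 / cell_form L0 g g)).
  rewrite ler_pdivrMr// mulrC -ler_pdivrMr//.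
  by rewrite ltW// truncnS_gt.
pose Q := [set cell_form L g g | L in setT].
have hsQ : has_sup Q.
  split; first by exists (cell_form 0 g g), 0%N.
  by exists C => _ [L _ <-].
have p0 : 0 < p.+1%:R^-1 :> R by rewrite invr_gt0.
have [_ [n1 _ <-] n1Q] := sup_adherent p0 hsQ.
exists (maxn L0 n1), p; split.
  by apply: (le_trans hp); apply: cell_form_nondecreasing => //; exact: leq_maxl.
move=> m _.
have h1 : cell_form m g g <= sup Q.
  by apply: ub_le_sup; [exact: hsQ.2|exists m].
apply: (le_trans h1); rewrite -lerBlDr (le_trans (ltW n1Q))//.
exact: cell_form_nondecreasing ag (leq_maxr L0 n1).
Qed.

End CellForms.

(** * Spectral pieces of the perturbed operators A + t K *)

Section Perturbation.
Context (R : realType) (H : completeNormedModType R[i]).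
Variable dot : {dot H for conjC}.
Hypothesis hip : inner_product dot.
Local Notation redot := (redot dot).
Local Notation T := (measurableTypeR R).
Variables (A K : H -> H) (sigma : {finite_measure set T -> \bar R}).
Hypotheses (lA : linear A) (lK : linear K).
Hypothesis sA : forall x y, redot (A x) y = redot x (A y).
Hypothesis sK : forall x y, redot (K x) y = redot x (K y).
Hypothesis pK : forall x, 0 <= redot (K x) x.

Definition perturbed (t : R) (x : H) : H := A x + t%:C *: K x.

Lemma perturbed_linear t : linear (perturbed t).
Proof.
move=> a x y; rewrite /perturbed lA lK !scalerDr !scalerA (mulrC a) addrACA.
by [].
Qed.

Lemma perturbed_sym t x y : redot (perturbed t x) y = redot x (perturbed t y).
Proof. by rewrite /perturbed redotDl redotDr redotZl redotZr sA sK. Qed.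

Variables (M : nat) (C : set T).
Hypothesis mC : measurable C.
Hypothesis CM : C `<=` window M.
Hypothesis thinC : thin M C.

Definition weight (L i : nat) : R := fine (sigma (C `&` cell M L i)).

Let mCc L i : measurable (C `&` cell M L i).
Proof. by apply: measurableI => //; exact: measurable_cell. Qed.

Lemma weight_ge0 L i : 0 <= weight L i.
Proof. exact: fine_ge0. Qed.

Lemma weight_split L i :
  weight L i = weight L.+1 (2 * i)%N + weight L.+1 (2 * i).+1.
Proof.
rewrite /weight -fineD ?fin_num_measure// cell_split setIUr measureU//.
by rewrite setIACA setIid cell_disjoint ?setI0//; lia.
Qed.

(** As |E(B) y|^2 = <E(B) y, y>, the second condition bounds the scalar spectral measure of y by the
    restriction of [sigma] to C. *)
Definition subordinate (t : R) (E : set T -> H -> H) (y : H) : Prop :=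
  [/\ spectral_resolution dot (perturbed t) E,
      forall B, measurable B -> redot (E B y) (E B y) <= fine (sigma (C `&` B)) &
      y != 0].

Definition pieces (E : set T -> H -> H) (y : H) (L i : nat) : H := E (cell M L i) y.

Section OneFiber.
Variables (t : R) (E : set T -> H -> H) (y : H).
Hypothesis tEy : subordinate t E y.

Let rE : spectral_resolution dot (perturbed t) E. Proof. by case: tEy. Qed.
Let pE : projection_valued_measure dot E := rE.1.
Let g := pieces E y.

Lemma pieces_le L i : redot (g L i) (g L i) <= weight L i.
Proof. by case: tEy => _ h _; apply: h; exact: measurable_cell. Qed.

Lemma pieces_adapted : adapted weight g.
Proof.
split => L i; last first.
  move=> w0; apply/eqP; rewrite -(redot_eq0 dot) eq_le redot_ge0 andbT -w0.
  exact: pieces_le.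
rewrite /g /pieces cell_split (pvm_setU hip pE)//; try exact: measurable_cell.
by rewrite cell_disjoint//; lia.
Qed.

Lemma pieces_orthogonal L i j : i != j -> redot (g L i) (g L j) = 0.
Proof.
move=> ij; rewrite /g /pieces (pvm_redot pE)//; try exact: measurable_cell.
by rewrite cell_disjoint// (pvm_set0 hip pE) redot0l.
Qed.

Lemma pieces_localized L i (a := dyad R M L i) :
  redot (perturbed t (g L i) - a%:C *: g L i) (perturbed t (g L i) - a%:C *: g L i)
    <= mesh R L ^+ 2 * redot (g L i) (g L i).
Proof.
apply: (spectral_localization hip pE rE (perturbed_linear t) (perturbed_sym t)).
- exact: measurable_cell.
- exact/ltW/mesh_gt0.
- by move=> l; rewrite cellE dyadS => /andP[h1 /ltW h2]; rewrite /= h1.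
Qed.

(** Divided by the square roots of their weights, the pieces are orthogonal of norm at most 1, so
    the trace bound applies. A piece of weight 0 is scaled to 0, since the inverse of 0 is 0. *)
Lemma pieces_form_le (c : R) L :
  (forall n (g : nat -> H),
    (forall i j, (i < n)%N -> (j < n)%N -> i != j -> redot (g i) (g j) = 0) ->
    (forall i, (i < n)%N -> redot (g i) (g i) <= 1) ->
    \sum_(i < n) redot (K (g i)) (g i) <= c) ->
  cell_form dot M weight K L g g <= c.
Proof.
move=> hc; pose r i := (Num.sqrt (weight L i))^-1.
have rr i : r i * r i = (weight L i)^-1.
  by rewrite /r -invfM -expr2 sqr_sqrtr// weight_ge0.
have := hc (ncells M L) (fun i => (r i)%:C *: g L i).
rewrite /cell_form (eq_bigr (fun i : 'I__ => redot (K (g L i)) (g L i) / weight L i)).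
  apply.
  - by move=> i j _ _ ij; rewrite redotZl redotZr pieces_orthogonal// !mulr0.
  - move=> i _; rewrite redotZl redotZr mulrA rr.
    have [w0|wn] := eqVneq (weight L i) 0; first by rewrite w0 invr0 mul0r.
    by rewrite mulrC ler_pdivrMr ?mul1r ?pieces_le// lt_neqAle eq_sym wn weight_ge0.
by move=> i _; rewrite (linZ lK) redotZl redotZr mulrA rr mulrC.
Qed.

Lemma window_sum n : E `[dyad R M 0 0, dyad R M 0 n[%classic y = \sum_(i < n) g 0 i.
Proof.
elim: n => [|n IH].
  by rewrite big_ord0 set_itv_ge ?(pvm_set0 hip pE)// bnd_simp ltxx.
rewrite big_ord_recr/= -IH -(pvm_setU hip pE).
- congr (E _ y); apply/seteqP; split => x; rewrite /setU/= ?in_itv/=.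
    move=> /andP[h1 h2]; case: (ltP x (dyad R M 0 n)) => h3; [left|right].
      by rewrite h1.
    by rewrite cellE h3.
  rewrite cellE dyadS; have := mesh_gt0 R 0; rewrite /dyad => m0.
  have : 0 <= n%:R * mesh R 0 by rewrite mulr_ge0// ltW.
  by move=> n0 [] /andP[h1 h2]; apply/andP; split; lra.
- exact: measurable_itv.
- exact: measurable_cell.
- apply/seteqP; split => // x [] /=; rewrite in_itv/= cellE => /andP[_ h1] /andP[h2 _].
  by have := lt_le_trans h1 h2; rewrite ltxx.
Qed.

(** The spectral measure of y is dominated by [sigma] on C, which lies in the window, so y has no
    component outside the window. *)
Lemma window_id : y = \sum_(i < ncells M 0) g 0 i.
Proof.
have mW := @measurable_window R M.
have mCW : measurable (~` window M : set T) by exact: measurableC.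
have [_ hy _] := tEy.
have E0 : E (~` window M) y = 0.
  apply/eqP; rewrite -(redot_eq0 dot) eq_le redot_ge0 andbT.
  apply: (le_trans (hy _ mCW)); rewrite (_ : _ `&` _ = set0) ?measure0//.
  by apply/seteqP; split => // x [/CM].
rewrite -window_sum.
have -> : `[dyad R M 0 0, dyad R M 0 (ncells M 0)[%classic = window M :> set T.
  have -> : dyad R M 0 0 = - M%:R by rewrite /dyad mul0r sub0r.
  have -> : dyad R M 0 (ncells M 0) = M%:R; last by [].
  by rewrite /dyad /ncells /mesh expr0 mulr1 expn0 muln1 natrM; ring.
rewrite -[LHS](_ : E setT y = _); last by rewrite (pvm_setT pE).
rewrite -(setUv (window M)) (pvm_setU hip pE) ?setICr// E0 addr0.
by [].
Qed.

(** The bound is shaped for summation over cells with [thinC]: pieces over cells missing C vanish,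
    and elsewhere the weight is bounded by the total mass. *)
Lemma localized_le L i v (V : R) : 0 <= V -> redot v v <= V ^+ 2 ->
  `|redot v (perturbed t (g L i) - (dyad R M L i)%:C *: g L i)| <=
  V * Num.sqrt (fine (sigma setT)) *
    (if `[< C `&` cell M L i = set0 >] then 0 else mesh R L).
Proof.
move=> V0 hV; have s0 := sqrtr_ge0 (fine (sigma setT)).
have wT : weight L i <= fine (sigma setT).
  apply: fine_le; rewrite ?fin_num_measure//.
  by apply: le_measure; rewrite ?inE.
have m0 := ltW (mesh_gt0 R L).
case: asboolP => Ci.
  have w0 : weight L i = 0 by rewrite /weight Ci measure0.
  have gz : g L i = 0 by apply: pieces_adapted.2.
  rewrite gz (lin0 (perturbed_linear t)) scaler0 subrr redot0r normr0 !mulr0.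
  by [].
rewrite -mulrA; apply: redot_le_norm => //; first by rewrite mulr_ge0.
apply: (le_trans (pieces_localized L i)).
rewrite exprMn mulrC ler_wpM2r ?sqr_ge0// sqr_sqrtr.
  exact: le_trans (pieces_le L i) wT.
exact: le_trans (weight_ge0 L i) wT.
Qed.

(* Otherwise the vectors orthogonal to all pieces form an A-invariant closed
   subspace containing Ran K, since A and A + t K agree on the pieces. *)
Lemma pieces_seen : cyclic_set A (range K) ->
  exists L i, (i < ncells M L)%N /\ K (g L i) != 0.
Proof.
move=> cyc; apply: contrapT => nex.
have Kg L i : K (g L i) = 0.
  have [iN|iN] := ltnP i (ncells M L).
    by apply/eqP; apply: contrapT => /negP h; apply: nex; exists L, i.
  suff -> : g L i = 0 by rewrite (lin0 lK).
  apply: pieces_adapted.2; rewrite /weight (_ : _ `&` _ = set0) ?measure0//.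
  apply/seteqP; split => // x [/CM wx ix].
  by have := cell_le_ncells ix wx; rewrite ltnNge iN.
(* [redot] only sees real parts; ranging over all complex c makes N a complex subspace. *)
pose N := [set v | forall (c : R[i]) L i, redot v (c *: g L i) = 0].
have redotZ (a : R[i]) u v : redot (a *: u) v = redot u ((a^*)%R *: v).
  by rewrite /redot dotZl dotZr conjCK.
have clN : closed_subspace N.
  split.
  - apply: (closed_of_approx hip) => u hu c L i.
    apply/eqP; rewrite -normr_le0 leNgt; apply/negP => r0.
    set z := c *: g L i in r0 *; set r := `|_| in r0.
    have s0 : 0 < Num.sqrt (redot z z) + 1 by rewrite ltr_wpDl// sqrtr_ge0.
    have e0 : 0 < r / 2 / (Num.sqrt (redot z z) + 1) by rewrite !divr_gt0.
    have [v Nv uv] := hu _ (exprn_gt0 2 e0).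
    have := redot_le_norm (ltW e0) (ltW s0) uv (_ : redot z z <= _).
    rewrite divfK ?gt_eqF// redotBl (Nv c L i) subr0 -/r.
    have le1 : redot z z <= (Num.sqrt (redot z z) + 1) ^+ 2.
      have := sqr_sqrtr (redot_ge0 dot z).
      have := sqrtr_ge0 (redot z z); move: (Num.sqrt _) => s; nra.
    by move/(_ le1); lra.
  - by move=> c L i; rewrite redot0l.
  - move=> a u v Nu Nv c L i.
    by rewrite redotDl redotZ scalerA Nu Nv addr0.
have AN : A @` N `<=` N.
  move=> _ [v Nv <-] c L i; rewrite sA (linZ lA).
  have Ag m j : A (g m j) = perturbed t (g m j).
    by rewrite /perturbed Kg scaler0 addr0.
  (* By subadditivity, the value at one cell is at most the sum over a finer level m. There,
     orthogonality of v to the pieces allows A to be replaced by A + t K - a, and thinness of C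
     makes the sum small. *)
  pose f m j := `|redot v (c *: A (g m j))|.
  have fsub m j : f m j <= f m.+1 (2 * j)%N + f m.+1 (2 * j).+1.
    rewrite /f {1}pieces_adapted.1 (linD lA) scalerDr redotDr.
    exact: ler_normD.
  have iNc : (ncells M L <= i)%N -> c *: A (g L i) = 0.
    move=> iN; suff -> : g L i = 0 by rewrite (lin0 lA) scaler0.
    apply: pieces_adapted.2; rewrite /weight (_ : _ `&` _ = set0) ?measure0//.
    apply/seteqP; split => // x [/CM wx ix].
    by have := cell_le_ncells ix wx; rewrite ltnNge iN.
  have [iN|/iNc->] := ltnP i (ncells M L); last by rewrite redot0r.
  apply/eqP; rewrite -normr_le0; apply/ler_addgt0Pr => e e0; rewrite add0r.
  pose u := (c^*)%R *: v.
  pose V := Num.sqrt (redot u u).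
  have fle m j : f m j <= V * Num.sqrt (fine (sigma setT)) *
      (if `[< C `&` cell M m j = set0 >] then 0 else mesh R m).
    have V2 : redot u u <= V ^+ 2 by rewrite sqr_sqrtr// redot_ge0.
    apply: le_trans (localized_le m j (sqrtr_ge0 _) V2).
    rewrite /f Ag redotBr /u redotZ conjCK.
    by rewrite [X in _ - X]redotZ conjCK scalerA Nv subr0.
  pose W := V * Num.sqrt (fine (sigma setT)).
  have W0 : 0 <= W by rewrite mulr_ge0// sqrtr_ge0.
  have W1 : 0 < W + 1 by rewrite ltr_wpDl.
  have [m Lm hm] := thinC L (divr_gt0 e0 W1).
  apply: (@le_trans _ _ (\sum_(j < ncells M m) f m j)).
    have := subadditive_cell_sum M fsub Lm; apply: le_trans.
    rewrite (bigD1 (Ordinal iN))//= -/(f L i) lerDl.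
    by apply: sumr_ge0 => j _; exact: normr_ge0.
  apply: (@le_trans _ _ (\sum_(j < ncells M m)
      W * (if `[< C `&` cell M m j = set0 >] then 0 else mesh R m))).
    by apply: ler_sum => j _; exact: fle.
  rewrite -mulr_sumr; apply: (@le_trans _ _ (W * (e / (W + 1)))).
    by rewrite ler_wpM2l// ltW.
  by rewrite mulrA ler_pdivrMr// mulrC ler_pM2l//; lra.
have KN : range K `<=` N.
  by move=> _ [x _ <-] c L i; rewrite sK (linZ lK) Kg scaler0 redot0r.
have NT : N = setT.
  by rewrite -subTset -cyc; apply: smallest_sub.
(* Every piece lies in N, hence is orthogonal to itself; then y, the sum of its pieces of level 0,
   is 0. *)
have [_ _ /eqP] := tEy; apply; rewrite window_id big1// => i _.
have : N (g 0 i) by rewrite NT.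
by move/(_ 1 0%N i); rewrite scale1r => /eqP; rewrite redot_eq0 => /eqP.
Qed.

(** By Cauchy-Schwarz for the form of K, a piece with K g != 0 has <K g, g> > 0. Its weight is
    positive because g is not 0, and the other terms are nonnegative. *)
Lemma pieces_form_pos : cyclic_set A (range K) ->
  exists L, 0 < cell_form dot M weight K L g g.
Proof.
move=> /pieces_seen[L [i [iN Kgi]]]; exists L.
have Kp : 0 < redot (K (g L i)) (g L i).
  rewrite lt_neqAle eq_sym pK andbT; apply: contra Kgi => /eqP K0.
  rewrite -(redot_eq0 dot); have := psd_CS lK sK pK (g L i) (K (g L i)).
  by rewrite K0 mul0r => h; rewrite -sqrf_eq0 eq_le h sqr_ge0.
have wp : 0 < weight L i.
  rewrite lt_neqAle weight_ge0 andbT eq_sym; apply: contra Kgi => /eqP w0.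
  by rewrite pieces_adapted.2// (lin0 lK).
rewrite /cell_form (bigD1 (Ordinal iN))//= ltr_pwDl ?divr_gt0// sumr_ge0// => j _.
by rewrite divr_ge0// weight_ge0.
Qed.

End OneFiber.

(* (s - t) K = (A + s K - a) - (A + t K - a), and on the piece over a cell at a
   the two terms have norm at most the length of the cell. *)
Lemma pieces_almost_orthogonal s t E F x y : s != t ->
  subordinate s E x -> subordinate t F y ->
  forall e L0, 0 < e -> exists2 L, (L0 <= L)%N &
    `|cell_form dot M weight K L (pieces E x) (pieces F y)| < e.
Proof.
move=> st sx ty e L0 e0; have d0 : 0 < `|s - t| by rewrite normr_gt0 subr_eq0.
(* Each cell meeting C contributes at most 2 / |s - t| times its length. *)
have e1 : 0 < e * `|s - t| / 2 by rewrite divr_gt0// mulr_gt0.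
have [L LL0 hL] := thinC L0 e1; exists L => //.
have bound i : `|redot (K (pieces E x L i)) (pieces F y L i) / weight L i| <=
    2 / `|s - t| * (if `[< C `&` cell M L i = set0 >] then 0 else mesh R L).
  case: asboolP => Ci.
    have w0 : weight L i = 0 by rewrite /weight Ci measure0.
    by rewrite w0 invr0 mulr0 normr0 mulr0.
  have m0 := mesh_gt0 R L.
  have [w0|wn] := eqVneq (weight L i) 0.
    by rewrite w0 invr0 mulr0 normr0 mulr_ge0 ?divr_ge0// ltW.
  have wp : 0 < weight L i by rewrite lt_neqAle eq_sym wn weight_ge0.
  have := pieces_localized sx L i; have := pieces_localized ty L i.
  have := pieces_le sx L i; have := pieces_le ty L i.
  set g := pieces E x L i; set h := pieces F y L i; set a := (dyad R M L i)%:C.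
  move=> hw gw hv hu; pose u := perturbed s g - a *: g; pose v := perturbed t h - a *: h.
  have E1 : (s - t) * redot (K g) h = redot u h - redot g v.
    rewrite /u /v /perturbed redotBl redotBr redotDl redotDr.
    rewrite !redotZl !redotZr sA sK; ring.
  have W2 : Num.sqrt (weight L i) ^+ 2 = weight L i by rewrite sqr_sqrtr// ltW.
  have W0 := sqrtr_ge0 (weight L i).
  have mW0 : 0 <= mesh R L * Num.sqrt (weight L i) by rewrite mulr_ge0// ltW.
  have hu' : redot u u <= (mesh R L * Num.sqrt (weight L i)) ^+ 2.
    by rewrite exprMn W2 (le_trans hu)// ler_wpM2l// sqr_ge0.
  have hv' : redot v v <= (mesh R L * Num.sqrt (weight L i)) ^+ 2.
    by rewrite exprMn W2 (le_trans hv)// ler_wpM2l// sqr_ge0.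
  have gw' : redot g g <= Num.sqrt (weight L i) ^+ 2 by rewrite W2.
  have hw' : redot h h <= Num.sqrt (weight L i) ^+ 2 by rewrite W2.
  have b1 := redot_le_norm mW0 W0 hu' hw'.
  have b2 := redot_le_norm W0 mW0 gw' hv'.
  (* Both pieces have norm at most the square root of the weight, so the denominator of the cell
     form cancels exactly. *)
  have b3 : `|s - t| * `|redot (K g) h| <= 2 * (mesh R L * weight L i).
    rewrite -normrM E1 (le_trans (ler_normB _ _))//.
    by rewrite -W2; move: b1 b2; lra.
  rewrite normrM normfV (gtr0_norm wp) ler_pdivrMr//.
  rewrite -(ler_pM2l d0) (le_trans b3)//.
  have -> : `|s - t| * (2 / `|s - t| * mesh R L * weight L i) =
     2 * (mesh R L * weight L i) by field; rewrite gt_eqF.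
  by [].
rewrite /cell_form; apply: (le_lt_trans (ler_norm_sum _ _ _)).
apply: (@le_lt_trans _ _ (\sum_(i < ncells M L) 2 / `|s - t| *
   (if `[< C `&` cell M L i = set0 >] then 0 else mesh R L))).
  by apply: ler_sum => i _; exact: bound.
rewrite -mulr_sumr mulrC mulrA ltr_pdivrMr// -ltr_pdivlMr//.
Qed.

End Perturbation.

(** * Countability *)

Section Coding.
Context (R : realType) (H : completeNormedModType R[i]).
Variable dot : {dot H for conjC}.
Hypothesis hip : inner_product dot.
Local Notation redot := (redot dot).
Local Notation T := (measurableTypeR R).

Lemma dense_redot (D : set H) z (e : R) : dense D -> 0 < e ->
  exists2 d, D d & redot (z - d) (z - d) <= e.
Proof.
move=> dD e0; have se0 : 0 < Num.sqrt e by rewrite sqrtr_gt0.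
have zb : (ball z (Num.sqrt e)%:C)° z by apply: nbhsx_ballx; rewrite ltcR.
have [|d [/interior_subset zd Dd]] := dD _ _ (@open_interior _ (ball z (Num.sqrt e)%:C)).
  by exists z.
exists d => //; move: zd; rewrite -ball_normE/= => /ltW.
by rewrite (le_norm_sqr hip) ?sqrtr_ge0// sqr_sqrtr// ltW.
Qed.

Lemma positive_form_bound (K : H -> H) : bounded_operator K ->
  exists2 c : R, 0 <= c & forall x, redot (K x) x <= c * redot x x.
Proof.
move=> /(bounded_redot hip)[c c0 hc]; exists c => // x.
have xx : redot x x = Num.sqrt (redot x x) ^+ 2 by rewrite sqr_sqrtr// redot_ge0.
have s0 := sqrtr_ge0 (redot x x).
apply: (le_trans (ler_norm _)); rewrite [in leRHS]xx expr2 mulrA.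
apply: redot_le_norm => //; first exact: mulr_ge0.
  by rewrite exprMn -xx hc.
by rewrite -xx.
Qed.

Variables (A K : H -> H) (sigma : {finite_measure set T -> \bar R}).
Hypotheses (lA : linear A) (lK : linear K).
Hypothesis sA : forall x y, redot (A x) y = redot x (A y).
Hypothesis sK : forall x y, redot (K x) y = redot x (K y).
Hypothesis pK : forall x, 0 <= redot (K x) x.
Variables (c : R) (tr : R).
Hypothesis c_ge0 : 0 <= c.
Hypothesis Kc : forall x, redot (K x) x <= c * redot x x.
Hypothesis Ktr : forall n (g : nat -> H),
    (forall i j, (i < n)%N -> (j < n)%N -> i != j -> redot (g i) (g j) = 0) ->
    (forall i, (i < n)%N -> redot (g i) (g i) <= 1) ->
    \sum_(i < n) redot (K (g i)) (g i) <= tr.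
Hypothesis cyc : cyclic_set A (range K).
Variable C : nat -> set T.
Hypothesis mC : forall k, measurable (C k).
Hypothesis CM : forall k, C k `<=` window k.
Hypothesis thinC : forall k, thin k (C k).
Variables (D : set H) (f : H -> nat).
Hypothesis dD : dense D.
Hypothesis fD : {in D &, injective f}.

Local Notation weight k := (weight sigma k (C k)).
Local Notation energy k := (cell_form dot k (weight k) K).

(** A squared distance, independent of t so that different parameters can share it. Pieces within it
    of common points differ by at most 4 times as much, and [energy_small] then bounds the energy of
    the difference by 1 / (p + 1). The + 1 keeps the denominator positive. *)
Definition radius (k n p : nat) : R :=
  p.+1%:R^-1 / (4 * (c * (\sum_(i < ncells k n) (weight k n i)^-1) + 1)).

Let inv_weights_ge0 k n : 0 <= \sum_(i < ncells k n) (weight k n i)^-1.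
Proof. by apply: sumr_ge0 => i _; rewrite invr_ge0 weight_ge0. Qed.

Let denominator_gt0 k n :
  0 < 4 * (c * (\sum_(i < ncells k n) (weight k n i)^-1) + 1).
Proof. by rewrite mulr_gt0// ltr_wpDl// mulr_ge0. Qed.

Lemma radius_gt0 k n p : 0 < radius k n p.
Proof. by rewrite divr_gt0// invr_gt0. Qed.

Lemma energy_small k n p (u : nat -> nat -> H) :
  (forall i, (i < ncells k n)%N -> redot (u n i) (u n i) <= 4 * radius k n p) ->
  energy k n u u <= p.+1%:R^-1.
Proof.
move=> hu; set s := \sum_(i < ncells k n) (weight k n i)^-1.
apply: (@le_trans _ _ (\sum_(i < ncells k n) c * (4 * radius k n p) * (weight k n i)^-1)).
  apply: ler_sum => i _; rewrite ler_wpM2r ?invr_ge0 ?weight_ge0//.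
  by apply: (le_trans (Kc _)); rewrite ler_wpM2l// hu.
rewrite -mulr_sumr -/s /radius -/s.
have p0 : 0 < p.+1%:R^-1 :> R by rewrite invr_gt0.
have cs0 : 0 <= c * s by rewrite mulr_ge0// inv_weights_ge0.
have -> : c * (4 * (p.+1%:R^-1 / (4 * (c * s + 1)))) * s =
    p.+1%:R^-1 * (c * s) / (c * s + 1).
  by field; rewrite gt_eqF ?ltr_wpDl//=; rewrite lt0r_neq0// -natr1 ltr_wpDl.
rewrite ler_pdivrMr ?ltr_wpDl// ler_pM2l//; lra.
Qed.

(* The code records the null set, the scale and level at which the energy of the
   pieces has almost stabilised, and an approximation of the pieces there. *)
Definition coded (t : R) (v : nat * nat * nat * seq nat) : Prop :=
  let: (k, n, p, s) := v in exists E y,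
  [/\ subordinate dot A K sigma (C k) t E y,
      4 * p.+1%:R^-1 <= energy k n (pieces k E y) (pieces k E y),
      forall m, (n <= m)%N -> energy k m (pieces k E y) (pieces k E y) <=
                              energy k n (pieces k E y) (pieces k E y) + p.+1%:R^-1 &
      forall i, (i < ncells k n)%N -> exists d, [/\ D d, f d = nth 0%N s i &
        redot (pieces k E y n i - d) (pieces k E y n i - d) <= radius k n p]].

(** Equal codes give equal approximants, so the difference of the pieces has energy at most d = 1 /
    (p + 1) at level n. For s != t, [cell_form_lower] keeps the mixed form at least 5 d / 2 from
    level n on, whereas [pieces_almost_orthogonal] brings it below d. *)
Lemma coded_inj s t v : coded s v -> coded t v -> s = t.
Proof.
case: v => [[[k n] p] q] [E [x [sx x4 xm xq]]] [F [y [ty y4 ym yq]]].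
apply/eqP; apply: contrapT => /negP st.
have p0 : 0 < p.+1%:R^-1 :> R by rewrite invr_gt0.
have close : energy k n (fun L i => pieces k E x L i - pieces k F y L i)
    (fun L i => pieces k E x L i - pieces k F y L i) <= p.+1%:R^-1.
  apply: energy_small => i iN.
  have [d [Dd fd hd]] := xq i iN; have [d' [Dd' fd' hd']] := yq i iN.
  have dd : d = d' by apply: fD; rewrite ?inE// fd fd'.
  rewrite -{}dd in hd'.
  have -> : pieces k E x n i - pieces k F y n i =
      (pieces k E x n i - d) - (pieces k F y n i - d).
    by rewrite opprB addrA subrK.
  apply: (le_trans (redot_normD _ _ _)).
  by rewrite redotNl redotNr opprK; lra.
have ax := pieces_adapted hip k sx; have ay := pieces_adapted hip k ty.
have w0 := weight_ge0 sigma k (C k); have wS := weight_split sigma k (mC k).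
have low := cell_form_lower w0 wS lK sK pK ax ay xm ym x4 y4 close.
have [m nm] := pieces_almost_orthogonal hip lA lK sA sK (thinC k) st sx ty n p0.
rewrite ltr_norml => /andP[_ h]; have := low m nm; move: p0 h.
set b := cell_form _ _ _ _ _ _ _; set d := _^-1 => d0 bd.
by rewrite leNgt => /negP; apply; lra.
Qed.

(** The trace bounds the energies and cyclicity makes one positive, so they stabilise at some level,
    whose finitely many pieces are approximated from D. *)
Lemma coded_exists k t E y : subordinate dot A K sigma (C k) t E y ->
  exists v, coded t v.
Proof.
move=> sy.
have w0 := weight_ge0 sigma k (C k); have wS := weight_split sigma k (mC k).
have ay := pieces_adapted hip k sy.
have le L := pieces_form_le hip lK k sy L Ktr.
have pos := pieces_form_pos hip lA lK sA sK pK (mC k) (@CM k) (thinC k) sy cyc.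
have [n [p [p4 pm]]] := cell_form_stable w0 wS lK sK pK ay le pos.
have approx i : exists z, D z /\
    redot (pieces k E y n i - z) (pieces k E y n i - z) <= radius k n p.
  by have [z] := dense_redot (pieces k E y n i) dD (radius_gt0 k n p); exists z.
have [d dP] := choice approx.
exists (k, n, p, [seq f (d i) | i <- iota 0 (ncells k n)]); exists E, y; split => //.
move=> i iN; exists (d i); have [h1 h2] := dP i; split => //.
by rewrite (nth_map 0%N) ?size_iota// nth_iota.
Qed.

(** On some S, mu <= n sigma and mu(S [&] C k) > 0. If mu is the spectral measure of x, the vector y
    = n^(-1/2) E(S [&] C k) x has spectral measure mu(B [&] S [&] C k) / n at B. *)
Lemma subordinate_exists t (mu : {finite_measure set T -> \bar R}) :
  (forall k, (sigma (window k `\` C k) <= (k.+1%:R^-1)%:E)%E) ->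
  is_spectral_measure dot (perturbed A K t) mu -> ~ mutually_singular mu sigma ->
  exists k E y, subordinate dot A K sigma (C k) t E y.
Proof.
move=> sC [E [x [rE _ muE]]] /(dominated_piece mC sC)[n [k [S [mS muS hS]]]].
have pE := rE.1; have mSC : measurable (S `&` C k) by exact: measurableI.
have muR B : measurable B -> fine (mu B) = redot (E B x) x.
  by move=> mB; rewrite muE.
pose r : R := (Num.sqrt n%:R)^-1.
have rr : r * r = n%:R^-1 by rewrite /r -invfM -expr2 sqr_sqrtr.
pose y := r%:C *: E (S `&` C k) x.
have yE B : measurable B ->
    redot (E B y) (E B y) = n%:R^-1 * fine (mu (B `&` (S `&` C k))).
  move=> mB; have mBS : measurable (B `&` (S `&` C k)) by exact: measurableI.
  rewrite /y (linZ (pvm_linear pE mB)) redotZl redotZr mulrA rr (pvm_comp pE)//.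
  by rewrite (pvm_redot_id pE)// muR.
exists k, E, y; split => //.
- move=> B mB; rewrite yE//.
  have mP : measurable (B `&` (S `&` C k)) by exact: measurableI.
  have := hS _ mP (fun z h => h.2.1).
  rewrite -(fineK (fin_num_measure mu _ mP)) -(fineK (fin_num_measure sigma _ mP)).
  rewrite -EFinM lee_fin => h.
  have [n0|n0] := eqVneq (n%:R : R) 0; first by rewrite n0 invr0 mul0r fine_ge0.
  have np : 0 < (n%:R : R) by rewrite lt_neqAle eq_sym n0 ler0n.
  rewrite mulrC ler_pdivrMr// mulrC (le_trans h)// ler_pM2l//.
  have mCB : measurable (C k `&` B) by exact: measurableI.
  apply: fine_le; rewrite ?fin_num_measure//; apply: le_measure; rewrite ?inE//.
  by move=> z [Bz [_ Cz]].
- apply/eqP => y0; have := yE setT measurableT.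
  rewrite (pvm_setT pE) setTI y0 redot0l.
  have : 0 < fine (mu (S `&` C k)) by rewrite -lte_fin fineK// fin_num_measure.
  (* If n were 0, domination by 0 times [sigma] would make mu vanish on S [&] C k. *)
  case: (n) hS => [|m] hS h0 /eqP.
    have := hS _ mSC (fun z h => h.1); rewrite mul0e leNgt.
    by rewrite muS.
  by rewrite eq_sym mulf_eq0 invr_eq0 pnatr_eq0/= gt_eqF.
Qed.

End Coding.

Theorem theorem1p2 (R : realType) (H : completeNormedModType R[i])
    (dot : {dot H for conjC}) (A K : H -> H)
    (sigma : {finite_measure set (measurableTypeR R) -> \bar R}) :
  inner_product dot -> separable H ->
  self_adjoint dot A -> self_adjoint dot K ->
  positive_operator dot K -> trace_class dot K ->
  singular_measure sigma ->
  cyclic_set A (range K) ->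
  exists Z : set R, countable Z /\
    forall t : R, ~ Z t ->
    forall mu : {finite_measure set (measurableTypeR R) -> \bar R},
      is_spectral_measure dot (fun x => A x + t%:C *: K x) mu ->
      mutually_singular mu sigma /\
      forall mu_s : {finite_measure set (measurableTypeR R) -> \bar R},
        is_singular_part mu mu_s -> mutually_singular mu_s sigma.
Proof.
move=> hip [D [cD dD]] saA saK posK trK sing cyc.
have [f fD] : exists f : H -> nat, {in D &, injective f} by apply/countable_injP.
have lA := saA.1.1; have lK := saK.1.1.
have sA := self_adjoint_redot saA; have sK := self_adjoint_redot saK.
have pK := positive_redot posK.
have [c c0 Kc] := positive_form_bound hip saK.1.
have [tr Ktr] := trace_bound hip posK trK.
have k0 k : 0 < (k.+1%:R^-1 : R) by rewrite invr_gt0.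
have hC k := thin_exhaustion k sing (k0 k).
have [C CP] := choice hC.
have mC k : measurable (C k) by have [] := CP k.
have CM k : C k `<=` window k by have [] := CP k.
have tC k : thin k (C k) by have [] := CP k.
have sC k : (sigma (window k `\` C k) <= (k.+1%:R^-1)%:E)%E by have [] := CP k.
pose Z := [set t : R | exists mu : {finite_measure set (measurableTypeR R) -> \bar R},
  is_spectral_measure dot (perturbed A K t) mu /\ ~ mutually_singular mu sigma].
have codeZ (t : R) : exists v, Z t -> coded dot A K sigma c C D f t v.
  (* Outside Z any code will do; the default only makes [code] a total function. *)
  have [[mu [smu nmu]]|nZ] := pselect (Z t); last by exists (0, 0, 0, [::])%N.
  have [k [E [y sy]]] := subordinate_exists mC sC smu nmu.
  have [v hv] := coded_exists hip lA lK sA sK pK c0 Ktr cyc mC CM tC f dD sy.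
  by exists v.
have [code codeP] := choice codeZ.
exists Z; split.
  apply/countable_injP; exists (pickle \o code) => s t /set_mem Zs /set_mem Zt /=.
  move/(pcan_inj pickleK) => st; have hs := codeP s Zs; have ht := codeP t Zt.
  rewrite st in hs.
  exact: (coded_inj hip lA lK sA sK pK c0 Kc mC tC fD hs ht).
move=> t nZt mu smu.
have ms : mutually_singular mu sigma.
  by apply: contrapT => nmu; apply: nZt; exists mu.
split => // mu_s [_ [mu_ac [_ muE]]].
(* The singular part is at most mu, so the same null set separates it from [sigma]. *)
have [N [mN muN sN]] := ms; exists N; split => //.
have := muE N mN; rewrite muN => /esym/eqP.
by rewrite padde_eq0// => /andP[_ /eqP].
Qed.
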